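(* Let $p\in(1,\infty)$, $M\ge 1$, $\varepsilon\in(0,1)$. There is a positive constant $C=C(M,p,\varepsilon)$, depending only on $M,p,\varepsilon$, such that for every $N$-dimensional subspace $L$ of $L^p(\mu)\cap C(\Omega)$ for which $$\|f\|_\infty\le M N^{\frac{1}{\max\{p,2\}}}\|f\|_{\max\{p,2\}}\quad\forall f\in L,$$ for every integer $m\ge C N[\log N]^{\max\{p,2\}}$ there are points $X_1,\ldots,X_m\in\Omega$ such that $$(1-\varepsilon)\|f\|_p^p\le\frac1m\sum_{j=1}^m|f(X_j)|^p\le(1+\varepsilon)\|f\|_p^p\quad\forall f\in L.$$
   Context: $\Omega$ is a compact set endowed with a Borel probability measure $\mu$. For $r\in[1,\infty)$, $\|f\|_r:=\bigl(\int_\Omega|f|^r\,d\mu\bigr)^{1/r}$, and $\|f\|_\infty:=\sup_{x\in\Omega}|f(x)|$.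
   Formalization: The formal theorem assumes N ≥ 2: for N = 1 the bound C N [log N]^{max{p,2}} is 0, so the claim would cover every m and fails (two points, uniform μ, |f|^p = 1/2 and 3/2, M = 2, m = 1, ε = 1/10), and for N = 0 log N is undefined. *)

(* Defs.v *)
From HB Require Import structures.
From mathcomp Require Import all_boot all_order all_algebra.
From mathcomp Require Import all_classical all_reals all_analysis.

Set Implicit Arguments.
Unset Strict Implicit.
Unset Printing Implicit Defensive.
Import Order.TTheory GRing.Theory Num.Theory.
Import numFieldNormedType.Exports.

Local Open Scope classical_set_scope.
Local Open Scope ring_scope.

(* The carrier of Omega, with its Borel sigma-algebra. *)
Notation borelType Omega := (g_sigma_algebraType (@open Omega)).

Definition linearly_independent (R : pzRingType) (V : lmodType R) (N : nat)
    (e : 'I_N -> V) : Prop :=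
  forall c : 'I_N -> R, \sum_(i < N) c i *: e i = 0 -> forall i, c i = 0.

Definition linear_span (R : pzRingType) (V : lmodType R) (N : nat)
    (e : 'I_N -> V) : set V :=
  [set \sum_(i < N) c i *: e i | c in [set: 'I_N -> R]].

Definition subspace_of_dim (R : pzRingType) (V : lmodType R) (N : nat)
    (L : set V) : Prop :=
  submod_closed (mem L) /\
  exists e : 'I_N -> V, linearly_independent e /\ L = linear_span e.

(* A genuine pointwise supremum, unlike the essential supremum of Lnorm at +oo;
   extended-real valued, so no boundedness convention is involved. *)
Definition sup_norm (T : Type) (R : realType) (f : T -> R) : \bar R :=
  ereal_sup [set `|f x|%:E | x in [set: T]].

(* Main.v *)
(** The points are chosen in two stages. A first sample [Y], of size polynomial
    in [N], replaces [mu] by a uniform measure on finitely many points, and the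
    final [m] points are sampled from [Y].

    Each stage truncates [|f|^p] at the dyadic levels [t = K, K/2, K/4, ...],
    where [K] bounds the unit ball of [L] in sup norm. The layer between two
    levels is at most [t^p] and is controlled by the values of a net of mesh
    comparable to [t]. A multiplicative Chernoff bound for the net functions
    costs [t^p * log (cardinality of the net)] points per level, up to an error
    proportional to the mean of the layer, and these means sum to at most
    [||f||_p^p].

    In the second stage the unit ball, on [n] points, has nets of mesh [t] of
    log-cardinality [O(N log n / t^p)], so each of the [O(log N)] levels costs
    [O(N log N)]. For [p >= 2] such a net comes from uniform convexity: if [w]
    has small norm in a convex set of functions, a function at distance more
    than [t] from [w] at one of the points lies in one of [2 n] half-spaces, on
    which [||.||_p^p] exceeds its value at [w] by a multiple of [t^p / N]; so a
    branching of depth [O(N / t^p)] exhausts the ball. For [p < 2] a net of mesh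
    [2 t] is refined to mesh [t] through balls of [L^2]. *)
Require Import Defs.
From HB Require Import structures.
From mathcomp Require Import all_boot all_order all_algebra.
From mathcomp Require Import all_classical all_reals all_analysis.
From mathcomp Require Import ring lra zify.

Set Implicit Arguments.
Unset Strict Implicit.
Unset Printing Implicit Defensive.
Import Order.TTheory GRing.Theory Num.Theory.
Import numFieldNormedType.Exports.

Local Open Scope classical_set_scope.
Local Open Scope ring_scope.

(** * Powers of nonnegative reals *)

(** Young's inequality for [b] and [a^(p-1)] with exponents [p] and [p / (p - 1)], cleared of
    denominators. It places the graph of the power above its tangent at [a], so it serves both
    Lipschitz bounds and convexity. *)
Lemma powR_young (R : realType) (p a b : R) : 1 < p -> 0 <= a -> 0 <= b ->
  p * (b * a `^ (p - 1)) <= b `^ p + (p - 1) * a `^ p.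
Proof.
move=> p1 a0 b0; have p0 : 0 < p by lra.
have q0 : 0 < p / (p - 1) by apply: divr_gt0; lra.
have pq : p^-1 + (p / (p - 1))^-1 = 1.
  by field; apply/andP; split; apply/eqP; lra.
have := conjugate_powR b0 (powR_ge0 a (p - 1)) p0 q0 pq.
rewrite -powRrM (_ : (p - 1) * (p / (p - 1)) = p); last by field; apply/eqP; lra.
rewrite (_ : a `^ p / (p / (p - 1)) = (p - 1) * a `^ p / p); last first.
  by field; apply/andP; split; apply/eqP; lra.
by rewrite -mulrDl ler_pdivlMr// mulrC.
Qed.

Lemma powR_tangent (R : realType) (p a b : R) : 1 < p -> 0 <= b -> b <= a ->
  a `^ p - b `^ p <= p * a `^ (p - 1) * (a - b).
Proof.
move=> p1 b0 ba; have p0 : 0 < p by lra.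
have a0 : 0 <= a by lra.
have := powR_young p1 a0 b0; have := mulr_powRB1 a0 p0; nra.
Qed.

Lemma powR_dist_le (R : realType) (p t a b : R) : 1 < p ->
  0 <= a <= t -> 0 <= b <= t ->
  `|a `^ p - b `^ p| <= p * t `^ (p - 1) * `|a - b|.
Proof.
move=> p1; wlog ba : a b / b <= a => [H|] /andP[a0 ta] /andP[b0 tb].
  have [|ab] := leP b a; first by move=> ?; apply: H; rewrite ?a0 ?b0.
  by rewrite distrC (distrC a); apply: H; rewrite ?a0 ?b0// ltW.
rewrite !ger0_norm ?subr_ge0//; last by rewrite ge0_ler_powR// ?nnegrE//; lra.
apply: (le_trans (powR_tangent p1 b0 ba)).
rewrite ler_wpM2r ?subr_ge0// ler_wpM2l ?ge0_ler_powR ?nnegrE//; lra.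
Qed.

Lemma continuous_normr_powR (R : realType) (p : R) : 1 < p ->
  continuous (fun u : R => `|u| `^ p).
Proof.
move=> p1 v; apply/(@cvgrPdist_le _ R) => e e0.
pose k := p * (`|v| + 1) `^ (p - 1).
have k0 : 0 < k by apply: mulr_gt0; [lra|apply: powR_gt0; have := normr_ge0 v; lra].
near=> u.
have uv1 : `|v - u| <= 1.
  near: u; apply: (@cvgrPdist_le _ R _ _ _ id v).1 => //.
have uvk : `|v - u| <= e / k.
  by near: u; apply: (@cvgrPdist_le _ R _ _ _ id v).1 => //; apply: divr_gt0.
apply: (@le_trans _ _ (k * `| `|v| - `|u| |)).
  apply: powR_dist_le => //; rewrite normr_ge0 /= ?lerDl//.
  by have := ler_dist_dist u v; rewrite ler_norml distrC; lra.
apply: (@le_trans _ _ (k * `|v - u|)); first by rewrite ler_pM2l// ler_dist_dist.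
by rewrite mulrC -ler_pdivlMr.
Unshelve. all: by end_near. Qed.

Lemma powR_superadd (R : realType) (r a b : R) : 1 <= r -> 0 <= a -> 0 <= b ->
  a `^ r + b `^ r <= (a + b) `^ r.
Proof.
move=> r1 a0 b0; have r0 : 0 < r by lra.
rewrite -!(mulr_powRB1 _ r0)//; last lra.
rewrite mulrDl lerD// ler_wpM2l// ge0_ler_powR ?nnegrE//; lra.
Qed.

Lemma powR_mid (R : realType) (r a b : R) : 1 <= r -> 0 <= a -> 0 <= b ->
  ((a + b) / 2) `^ r <= (a `^ r + b `^ r) / 2.
Proof.
move=> r1 a0 b0.
have [<-|r1'] := eqVneq 1 r; first by rewrite !powRr1//; lra.
have {}r1 : 1 < r by rewrite lt_neqAle r1' r1.
have c0 : 0 <= (a + b) / 2 by lra.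
have r0 : 0 < r by lra.
have := powR_young r1 c0 a0; have := powR_young r1 c0 b0.
have := mulr_powRB1 c0 r0; nra.
Qed.

(** Write each power as the [p / 2]-th power of a square. Superadditivity bounds the left side by
    the power of the sum of the two squares, which is [(a^2 + b^2) / 2] by the parallelogram
    identity; convexity concludes. *)
Lemma clarkson_powR (R : realType) (p a b : R) : 2 <= p ->
  `|(a + b) / 2| `^ p + `|(b - a) / 2| `^ p <= (`|a| `^ p + `|b| `^ p) / 2.
Proof.
move=> p2; set r := p / 2.
have r1 : 1 <= r by rewrite /r; lra.
have E (x : R) : `|x| `^ p = (x ^+ 2) `^ r.
  by rewrite -real_normK ?num_real// -powR_mulrn// -powRrM; congr (_ `^ _); rewrite /r; field.
rewrite !E.
apply: (le_trans (powR_superadd r1 (sqr_ge0 _) (sqr_ge0 _))).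
rewrite (_ : _ + _ = (a ^+ 2 + b ^+ 2) / 2); last by field.
by apply: powR_mid => //; exact: sqr_ge0.
Qed.

Lemma powR_normB (R : realType) (p a b : R) : 0 < p ->
  `|a - b| `^ p <= 2 `^ p * (`|a| `^ p + `|b| `^ p).
Proof.
move=> p0; apply: (@le_trans _ _ ((2 * Num.max `|a| `|b|) `^ p)).
  have M0 : 0 <= Num.max `|a| `|b| by rewrite le_max normr_ge0.
  apply: ge0_ler_powR; rewrite ?nnegrE ?mulr_ge0//; first exact: ltW.
  apply: (le_trans (ler_normB _ _)).
  by have [] := leP `|a| `|b|; lra.
rewrite powRM// ?le_max ?normr_ge0// ler_wpM2l ?powR_ge0//.
by have [] := leP `|a| `|b|; rewrite ?lerDl ?lerDr powR_ge0.
Qed.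

(** From [1 - u <= expR (- u)] one gets [expR u <= 1 / (1 - u)], and [(1 - u) * (1 + u + 2 u^2) = 1
    + u^2 * (1 - 2 u)] is at least 1. *)
Lemma expR_le_quad (R : realType) (u : R) : `|u| <= 2^-1 ->
  expR u <= 1 + u + 2 * u ^+ 2.
Proof.
rewrite ler_norml => /andP[u1 u2].
have := expR_ge1Dx (- u); rewrite expRN => H.
rewrite -[expR u]invrK; have P : 0 < (1 - u) by lra.
apply: (@le_trans _ _ (1 - u)^-1); first by rewrite lef_pV2// posrE invr_gt0 expR_gt0.
by rewrite -div1r ler_pdivrMr//; nra.
Qed.

(** * Sampling for an abstract expectation *)

(* Instantiated both with [mu] on the continuous functions and with uniform
   measures on finite sets, where every function is in the domain. *)
Record expectation (R : realType) (T : Type) := Expectation {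
  dom : set (T -> R);
  ev : (T -> R) -> R;
  dom_cst : forall c, dom (fun=> c);
  dom_lin : forall a f g, dom f -> dom g -> dom (fun x => a * f x + g x);
  dom_comp : forall phi f, continuous phi -> dom f -> dom (fun x => phi (f x));
  dom_bounded : forall f, dom f -> exists b, forall x, `|f x| <= b;
  ev_cst : forall c, ev (fun=> c) = c;
  ev_lin : forall a f g, dom f -> dom g ->
    ev (fun x => a * f x + g x) = a * ev f + ev g;
  ev_le : forall f g, dom f -> dom g -> (forall x, f x <= g x) -> ev f <= ev g }.

Arguments ev {R T} e f.
Arguments dom {R T} e f.

Lemma ev_ext (R : realType) (T : Type) (E : expectation R T) (f g : T -> R) :
  f =1 g -> ev E f = ev E g.
Proof. by move=> /funext ->. Qed.

Lemma dom_ext (R : realType) (T : Type) (E : expectation R T) (f g : T -> R) :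
  f =1 g -> dom E f -> dom E g.
Proof. by move=> /funext ->. Qed.

Lemma domZ (R : realType) (T : Type) (E : expectation R T) a f :
  dom E f -> dom E (fun x => a * f x).
Proof.
move=> df; apply: dom_ext (dom_lin a df (dom_cst E 0)) => x /=.
by rewrite addr0.
Qed.

Lemma domD (R : realType) (T : Type) (E : expectation R T) f g :
  dom E f -> dom E g -> dom E (fun x => f x + g x).
Proof.
by move=> df dg; apply: dom_ext (dom_lin 1 df dg) => x /=; rewrite mul1r.
Qed.

Lemma domB (R : realType) (T : Type) (E : expectation R T) f g :
  dom E f -> dom E g -> dom E (fun x => f x - g x).
Proof.
move=> df dg; apply: dom_ext (dom_lin (-1) dg df) => x /=.
by rewrite mulN1r addrC.
Qed.

Lemma dom_sum (R : realType) (T : Type) (E : expectation R T) (J : eqType)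
    (s : seq J) (F : J -> T -> R) : (forall j, j \in s -> dom E (F j)) ->
  dom E (fun x => \sum_(j <- s) F j x).
Proof.
elim: s => [|j s IH] H.
  by apply: dom_ext (dom_cst E 0) => x; rewrite big_nil.
have dj : dom E (F j) by apply: H; rewrite mem_head.
have ds : dom E (fun x => \sum_(j <- s) F j x).
  by apply: IH => k ks; apply: H; rewrite inE ks orbT.
by apply: dom_ext (domD dj ds) => x; rewrite big_cons.
Qed.

Lemma evZ (R : realType) (T : Type) (E : expectation R T) a f :
  dom E f -> ev E (fun x => a * f x) = a * ev E f.
Proof.
move=> df; have := ev_lin a df (dom_cst E 0); rewrite ev_cst addr0 => <-.
by apply: ev_ext => x; rewrite addr0.
Qed.

Lemma evD (R : realType) (T : Type) (E : expectation R T) f g :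
  dom E f -> dom E g -> ev E (fun x => f x + g x) = ev E f + ev E g.
Proof.
move=> df dg; have := ev_lin 1 df dg; rewrite mul1r => <-.
by apply: ev_ext => x; rewrite mul1r.
Qed.

Lemma evB (R : realType) (T : Type) (E : expectation R T) f g :
  dom E f -> dom E g -> ev E (fun x => f x - g x) = ev E f - ev E g.
Proof.
move=> df dg; have := ev_lin (-1) dg df; rewrite mulN1r addrC => <-.
by apply: ev_ext => x; rewrite mulN1r addrC.
Qed.

Lemma ev_sum (R : realType) (T : Type) (E : expectation R T) (J : eqType)
    (s : seq J) (F : J -> T -> R) : (forall j, j \in s -> dom E (F j)) ->
  ev E (fun x => \sum_(j <- s) F j x) = \sum_(j <- s) ev E (F j).
Proof.
elim: s => [|j s IH] H.
  by rewrite big_nil -[RHS](ev_cst E); apply: ev_ext => x; rewrite big_nil.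
have dj : dom E (F j) by apply: H; rewrite mem_head.
have Hs k : k \in s -> dom E (F k) by move=> ks; apply: H; rewrite inE ks orbT.
rewrite big_cons -IH// -evD//; last exact: dom_sum.
by apply: ev_ext => x; rewrite big_cons.
Qed.

Lemma ev_ge0 (R : realType) (T : Type) (E : expectation R T) f :
  dom E f -> (forall x, 0 <= f x) -> 0 <= ev E f.
Proof. by move=> df f0; rewrite -(ev_cst E 0); apply: ev_le => //; exact: dom_cst. Qed.

Lemma ev_exists (R : realType) (T : Type) (E : expectation R T) f c :
  dom E f -> ev E f < c -> exists x, f x < c.
Proof.
move=> df; apply: contraPP => /forallNP H; apply/negP; rewrite -leNgt.
rewrite -(ev_cst E c); apply: ev_le => [|//|x]; first exact: dom_cst.
by rewrite leNgt; apply/negP/H.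
Qed.

Lemma dom_powR (R : realType) (T : Type) (E : expectation R T) (p : R) f :
  1 < p -> dom E f -> dom E (fun x => `|f x| `^ p).
Proof.
by move=> p1; apply: (@dom_comp _ _ E (fun u => `|u| `^ p)); exact: continuous_normr_powR.
Qed.

Lemma dom_sqr (R : realType) (T : Type) (E : expectation R T) f :
  dom E f -> dom E (fun x => f x ^+ 2).
Proof.
apply: (@dom_comp _ _ E (fun u => u ^+ 2)) => u; exact: exprn_continuous.
Qed.

Lemma domM (R : realType) (T : Type) (E : expectation R T) f g :
  dom E f -> dom E g -> dom E (fun x => f x * g x).
Proof.
move=> df dg.
(* Polarisation: a product is a quarter of the difference of two squares, and squares are
   compositions with a continuous function of one variable. *)
have := domZ 4^-1 (domB (dom_sqr (domD df dg)) (dom_sqr (domB df dg))).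
by apply: dom_ext => x; field.
Qed.

Lemma dom_exp (R : realType) (T : Type) (E : expectation R T) s f :
  dom E f -> dom E (fun x => expR (s * f x)).
Proof.
move=> df; apply: (@dom_comp _ _ E expR) (domZ s df); exact: continuous_expR.
Qed.

(** As [0 <= h <= b], the second moment is at most [b * ev E h]. The exponent is thus proportional
    to the mean, which later makes the sampling error of a layer relative to its mean. *)
Lemma laplace_bound (R : realType) (T : Type) (E : expectation R T) (s b : R) h :
  dom E h -> (forall x, 0 <= h x <= b) -> `|s| * b <= 2^-1 ->
  ev E (fun x => expR (s * (h x - ev E h))) <= expR (2 * s ^+ 2 * b * ev E h).
Proof.
move=> dh hb sb.
have e0 : 0 <= ev E h by apply: ev_ge0 => // x; have /andP[] := hb x.
have eb : ev E h <= b.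
  by rewrite -(ev_cst E b); apply: ev_le => // [|x]; [exact: dom_cst|have /andP[] := hb x].
have dc : dom E (fun x => h x - ev E h) by apply: domB => //; exact: dom_cst.
have dh2 : dom E (fun x => h x ^+ 2) by exact: dom_sqr.
have dq : dom E (fun x => 2 * s ^+ 2 * h x ^+ 2
             + ((s - 4 * s ^+ 2 * ev E h) * h x + (1 - s * ev E h + 2 * s ^+ 2 * ev E h ^+ 2))).
  by do 2!apply: dom_lin => //; exact: dom_cst.
apply: (@le_trans _ _ (ev E (fun x => 2 * s ^+ 2 * h x ^+ 2
   + ((s - 4 * s ^+ 2 * ev E h) * h x + (1 - s * ev E h + 2 * s ^+ 2 * ev E h ^+ 2))))).
  apply: ev_le => //; first exact: dom_exp.
  move=> x; set e := ev E h.
  have := @expR_le_quad R (s * (h x - e)).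
  have -> : 1 + s * (h x - e) + 2 * (s * (h x - e)) ^+ 2 =
    2 * s ^+ 2 * h x ^+ 2 + ((s - 4 * s ^+ 2 * e) * h x + (1 - s * e + 2 * s ^+ 2 * e ^+ 2)).
    by ring.
  apply; rewrite normrM; apply: le_trans sb; rewrite ler_wpM2l//.
  by have /andP[] := hb x; rewrite ler_norml /e; lra.
rewrite !ev_lin//; [|exact: dom_cst|by apply: dom_lin => //; exact: dom_cst].
rewrite ev_cst.
have h2 : ev E (fun x => h x ^+ 2) <= b * ev E h.
  rewrite -evZ//; apply: ev_le => // [|x]; first exact: domZ.
  by have /andP[] := hb x; rewrite expr2 => *; rewrite ler_wpM2r.
apply: le_trans (expR_ge1Dx _).
set e := ev E h in e0 eb h2 *; have s2 := sqr_ge0 s.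
have : s ^+ 2 * ev E (fun x => h x ^+ 2) <= s ^+ 2 * (b * e) by rewrite ler_wpM2l.
have : 0 <= s ^+ 2 * e ^+ 2 by rewrite mulr_ge0 ?sqr_ge0.
lra.
Qed.

(* The random points are found one at a time: the exponential potential of the
   points already chosen does not increase in mean, so some next point keeps it
   below 1, and no product measure is needed. *)
Lemma chernoff_points (R : realType) (T : Type) (E : expectation R T)
    (J : eqType) (js : seq J) (h : J -> T -> R) (b s lam : J -> R) (m : nat) :
  (forall j, j \in js -> dom E (h j)) ->
  (forall j x, j \in js -> 0 <= h j x <= b j) ->
  (forall j, j \in js -> `|s j| * b j <= 2^-1) ->
  \sum_(j <- js) expR (- lam j) < 1 ->
  exists2 X : seq T, size X = m & forall j, j \in js ->
    s j * (\sum_(x <- X) h j x - m%:R * ev E (h j)) <=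
      m%:R * (2 * s j ^+ 2 * b j * ev E (h j)) + lam j.
Proof.
move=> dh hb sb lam1.
pose c j := 2 * s j ^+ 2 * b j * ev E (h j).
pose expo X j := s j * (\sum_(x <- X) h j x - (size X)%:R * ev E (h j))
                 - (size X)%:R * c j - lam j.
suff [X Xm H] : exists2 X : seq T, size X = m & \sum_(j <- js) expR (expo X j) < 1.
  exists X => // j jj; rewrite -/(c j) -Xm -subr_le0 opprD addrA -/(expo X j).
  rewrite leNgt -expR_gt1 -leNgt; apply: le_trans (ltW H).
  by rewrite (big_rem j)//= lerDl sumr_ge0// => k _; exact: expR_ge0.
elim: m => [|m [X Xm IH]].
  exists [::] => //; apply: le_lt_trans lam1; apply: ler_sum => j _.
  by rewrite /expo big_nil/= !(mul0r, oppr0, mulr0, add0r).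
pose F j x := expR (expo X j - c j) * expR (s j * (h j x - ev E (h j))).
have dF j : j \in js -> dom E (F j).
  by move=> jj; apply/domZ/dom_exp/domB; [exact: dh|exact: dom_cst].
have [x xlt] : exists x, \sum_(j <- js) F j x < 1.
  apply: (@ev_exists _ _ E); first exact: dom_sum.
  rewrite ev_sum//; apply: le_lt_trans IH.
  rewrite !big_seq; apply: ler_sum => j jj.
  rewrite /F evZ; last by apply/dom_exp/domB; [exact: dh|exact: dom_cst].
  rewrite -[leRHS]mulr1 expRD -mulrA ler_wpM2l ?expR_ge0//.
  rewrite expRN mulrC ler_pdivrMr ?expR_gt0// mul1r.
  apply: laplace_bound; [exact: dh|by move=> ?; exact: hb|exact: sb].
exists (x :: X); rewrite /= ?Xm//; apply: le_lt_trans xlt.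
apply: ler_sum => j _; rewrite /F -expRD ler_expR /expo big_cons /= -addn1 natrD.
by rewrite le_eqVlt; apply/orP; left; apply/eqP; ring.
Qed.

(** [chernoff_points] with [s = th / b] taken with both signs, hence the factor 2 in the weights.
    After division by [s], the quadratic term is a relative error [2 * th] and [lam] costs
    [b * lam / th]. *)
Lemma bernstein_points (R : realType) (T : Type) (E : expectation R T)
    (J : eqType) (js : seq J) (h : J -> T -> R) (b lam : J -> R) (th : R) (m : nat) :
  0 < th <= 2^-1 ->
  (forall j, j \in js -> [/\ dom E (h j), 0 < b j & forall x, 0 <= h j x <= b j]) ->
  \sum_(j <- js) 2 * expR (- lam j) < 1 ->
  exists2 X : seq T, size X = m & forall j, j \in js ->
    `|\sum_(x <- X) h j x - m%:R * ev E (h j)| <=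
      2 * th * m%:R * ev E (h j) + b j * lam j / th.
Proof.
move=> /andP[th0 th2] H lam1.
pose jb : seq (J * bool) := [seq (j, c) | j <- js, c <- [:: true; false]].
have mem j c : ((j, c) \in jb) = (j \in js).
  apply/allpairsP/idP => [[[k d] [/= kj _ [-> _]]]//|jj].
  by exists (j, c); split => //; case: c.
have mem' j : j \in jb -> j.1 \in js by case: j => j c; rewrite mem.
pose s (j : J * bool) := (-1) ^+ j.2 * (th / b j.1).
have [j /mem' /H[]//|j x /mem' /H[]//|j /mem' /H[_ b0 _]||X Xm HX] :=
  @chernoff_points R T E _ jb (fun j => h j.1) (fun j => b j.1) s (fun j => lam j.1) m.
- rewrite normrM normrX normrN1 expr1n mul1r ger0_norm ?divr_ge0 ?(ltW th0) ?(ltW b0)//.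
  by rewrite divfK ?gt_eqF.
- rewrite big_allpairs; apply: le_lt_trans lam1; apply: ler_sum => j _.
  by rewrite !big_cons big_nil /= addr0 mulr_natl mulr2n.
exists X => // j jj; have [_ b0 _] := H _ jj.
have bt : 0 < b j / th by rewrite divr_gt0.
have key c : (-1) ^+ nat_of_bool c * (\sum_(x <- X) h j x - m%:R * ev E (h j)) <=
    2 * th * m%:R * ev E (h j) + b j * lam j / th.
  have := HX (j, c); rewrite mem jj => /(_ isT); rewrite /s /=.
  set D := _ - _; set sg := _ ^+ _.
  have sg2 : sg ^+ 2 = 1 by rewrite /sg sqrr_sign.
  rewrite -(ler_pM2l bt) exprMn sg2 => {}HX; apply: (le_trans _ (le_trans HX _)).
    rewrite le_eqVlt; apply/orP; left; apply/eqP; field.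
    by rewrite !gt_eqF.
  rewrite le_eqVlt; apply/orP; left; apply/eqP; field.
  by rewrite !gt_eqF.
rewrite ler_norml; have := key false; have := key true.
by rewrite expr0 expr1 mul1r mulN1r lerNl => -> ->.
Qed.

(** * Decomposition into levels *)

Definition trunc_powR (R : realType) (p t u : R) : R := (Num.min `|u| t) `^ p.

Definition level_powR (R : realType) (p t u : R) : R :=
  trunc_powR p t u - trunc_powR p (t / 2) u.

Lemma trunc_powR_ge0 (R : realType) (p t u : R) : 0 <= trunc_powR p t u.
Proof. exact: powR_ge0. Qed.

Lemma trunc_powR_le (R : realType) (p t u : R) : 0 <= p -> 0 <= t ->
  trunc_powR p t u <= t `^ p.
Proof.
move=> p0 t0; apply: ge0_ler_powR; rewrite ?nnegrE ?le_min ?normr_ge0//.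
by rewrite ge_min lexx orbT.
Qed.

Lemma trunc_powR_le_norm (R : realType) (p t u : R) : 0 <= p -> 0 <= t ->
  trunc_powR p t u <= `|u| `^ p.
Proof.
move=> p0 t0; apply: ge0_ler_powR; rewrite ?nnegrE ?le_min ?normr_ge0//.
by rewrite ge_min lexx.
Qed.

Lemma trunc_powR_id (R : realType) (p t u : R) : `|u| <= t ->
  trunc_powR p t u = `|u| `^ p.
Proof. by move=> ut; rewrite /trunc_powR min_l. Qed.

Lemma level_powR_ge0 (R : realType) (p t u : R) : 0 <= p -> 0 <= t ->
  0 <= level_powR p t u.
Proof.
move=> p0 t0; rewrite subr_ge0; apply: ge0_ler_powR; rewrite ?nnegrE ?le_min ?normr_ge0//; try lra.
by rewrite ge_min lexx/= ge_min; apply/orP; right; lra.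
Qed.

Lemma level_powR_le (R : realType) (p t u : R) : 0 <= p -> 0 <= t ->
  level_powR p t u <= t `^ p.
Proof.
move=> p0 t0; rewrite lerBlDr (le_trans (trunc_powR_le _ p0 t0))//.
by rewrite lerDl trunc_powR_ge0.
Qed.

Lemma dist_minl (R : realType) (a b t : R) :
  `|Num.min a t - Num.min b t| <= `|a - b|.
Proof.
by have [|] := leP a t; have [|] := leP b t => *; rewrite ?subrr ?normr0//;
  rewrite !ler_norml; apply/andP; split; have := ler_norm (a - b);
  have := ler_norm (- (a - b)); rewrite normrN; lra.
Qed.

Lemma trunc_powR_dist (R : realType) (p t u v : R) : 1 < p -> 0 <= t ->
  `|trunc_powR p t u - trunc_powR p t v| <= p * t `^ (p - 1) * `|u - v|.
Proof.
move=> p1 t0.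
apply: (@le_trans _ _ (p * t `^ (p - 1) * `|Num.min `|u| t - Num.min `|v| t|)).
  by apply: powR_dist_le => //; rewrite le_min normr_ge0 t0 ge_min lexx orbT.
rewrite ler_wpM2l ?mulr_ge0 ?powR_ge0//; first lra.
by apply: le_trans (dist_minl _ _ _) _; exact: ler_dist_dist.
Qed.

(** If [|u| < t / 4], then [|v| <= t / 2] and both layers vanish. Otherwise the layer of [4 * u] is
    full, so at least [t^p / 2], and absorbs the Lipschitz bound. Since the error is again a layer,
    it telescopes when summed over the levels. *)
Lemma level_powR_dist (R : realType) (p t d u v : R) : 1 < p -> 0 < t ->
  d <= 4^-1 -> `|u - v| <= d * t ->
  `|level_powR p t u - level_powR p t v| <= 4 * p * d * level_powR p t (4 * u).
Proof.
move=> p1 t0 d4 uv.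
have d0 : 0 <= d by rewrite -(pmulr_lge0 _ t0); apply: le_trans uv.
have p0 : 0 <= p by lra.
have t2 : 0 < t / 2 by lra.
have [ut|ut] := ltP `|u| (t / 4).
  have vt : `|v| <= t / 2.
    have dt : d * t <= 4^-1 * t by rewrite ler_wpM2r// ltW.
    have H1 : `|v| - `|u| <= `|u - v|.
      by rewrite distrC; apply: le_trans (ler_norm _) (ler_dist_dist _ _).
    lra.
  have lvl0 w : `|w| <= t / 2 -> level_powR p t w = 0.
    by move=> wt; rewrite /level_powR !trunc_powR_id ?subrr//; lra.
  rewrite (lvl0 u) ?(lvl0 v)//; last lra.
  rewrite subrr normr0 mulr_ge0 ?mulr_ge0//; exact: (level_powR_ge0 _ p0 (ltW t0)).
have -> : level_powR p t (4 * u) = t `^ p - (t / 2) `^ p.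
  by rewrite /level_powR /trunc_powR normrM ger0_norm// !min_r//; lra.
have h2 : (t / 2) `^ p <= t `^ p / 2.
  rewrite powRM ?invr_ge0 ?(ltW t0)// ler_wpM2l ?powR_ge0//.
  by apply: ge1r_powR; lra.
have E1 : t `^ (p - 1) * t = t `^ p by rewrite mulrC mulr_powRB1 ?(ltW t0)//; lra.
have E2 : (t / 2) `^ (p - 1) <= t `^ (p - 1) by apply: ge0_ler_powR; rewrite ?nnegrE; lra.
have D1 := trunc_powR_dist u v p1 (ltW t0).
have D2 := trunc_powR_dist u v p1 (ltW t2).
have B1 : p * t `^ (p - 1) * `|u - v| <= p * d * t `^ p.
  rewrite -E1 -!mulrA ler_wpM2l// [leRHS]mulrCA ler_wpM2l ?powR_ge0//.
have B2 : p * (t / 2) `^ (p - 1) * `|u - v| <= p * t `^ (p - 1) * `|u - v|.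
  by rewrite ler_wpM2r// ler_wpM2l.
rewrite /level_powR (_ : forall a b c e : R, a - b - (c - e) = (a - c) - (b - e)); last first.
  by move=> *; ring.
apply: (le_trans (ler_normB _ _)).
have pd : 0 <= p * d by rewrite mulr_ge0.
have : p * d * (t / 2) `^ p <= p * d * (t `^ p / 2) by rewrite ler_wpM2l.
lra.
Qed.

Lemma continuous_trunc_powR (R : realType) (p t : R) : 1 < p -> 0 <= t ->
  continuous (trunc_powR p t).
Proof.
move=> p1 t0; have -> : trunc_powR p t =
    (fun u => `|u| `^ p) \o (fun u => Num.min `|u| t).
  apply/funext => u /=; rewrite /trunc_powR.
  by rewrite (@ger0_norm _ (Num.min _ _))// le_min normr_ge0.
move=> u; apply: continuous_comp; last exact: continuous_normr_powR.
by apply: continuous_min; [exact: norm_continuous|exact: cst_continuous].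
Qed.

Lemma dom_level (R : realType) (T : Type) (E : expectation R T) (p t : R) f :
  1 < p -> 0 <= t -> dom E f -> dom E (fun x => level_powR p t (f x)).
Proof.
move=> p1 t0 df.
apply: domB; apply: (@dom_comp _ _ E (trunc_powR p _)) => //;
  apply: continuous_trunc_powR => //; lra.
Qed.

Lemma sum_level_powR (R : realType) (p K u : R) (n : nat) :
  \sum_(l < n) level_powR p (K / 2 ^+ l) u =
    trunc_powR p K u - trunc_powR p (K / 2 ^+ n) u.
Proof.
elim: n => [|n IH]; first by rewrite big_ord0 expr0 divr1 subrr.
rewrite big_ord_recr /= IH /level_powR exprSr invfM mulrA.
by rewrite addrA subrK.
Qed.

Definition lin_closed (R : realType) (T : Type) (V : set (T -> R)) : Prop :=
  forall a f g, V f -> V g -> V (fun x => a * f x + g x).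

Lemma lin_comb (R : realType) (T : Type) (V : set (T -> R)) a f g :
  lin_closed V -> V f -> V g -> V (fun x => a * f x + g x).
Proof. by move=> Vlin; exact: Vlin. Qed.

Lemma lin_scale (R : realType) (T : Type) (V : set (T -> R)) c f :
  lin_closed V -> V f -> V (fun x => c * f x).
Proof.
(* The zero function arises as [-1 * f + f]. *)
move=> Vlin Vf; have := lin_comb c Vlin Vf (lin_comb (-1) Vlin Vf Vf).
by congr (V _); apply/funext => x; ring.
Qed.

(** Stated for [p]-th powers, so that under the hypothesis of the theorem the constant is linear in
    the dimension. *)
Definition nikolskii (R : realType) (T : Type) (E : expectation R T)
    (L : set (T -> R)) (p A : R) : Prop :=
  forall f x, L f -> `|f x| `^ p <= A * ev E (fun y => `|f y| `^ p).

Definition covers (R : realType) (T : Type) (E : expectation R T)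
    (L : set (T -> R)) (p t : R) (G : seq (T -> R)) : Prop :=
  forall f, L f -> ev E (fun y => `|f y| `^ p) <= 1 ->
  exists2 g, g \in G & forall x, `|f x - g x| <= t.

Definition discretizes (R : realType) (T : Type) (E : expectation R T)
    (L : set (T -> R)) (p eps : R) (X : seq T) : Prop :=
  forall f, L f ->
  `|\sum_(x <- X) `|f x| `^ p - (size X)%:R * ev E (fun y => `|f y| `^ p)| <=
    eps * (size X)%:R * ev E (fun y => `|f y| `^ p).

(** A test [j] packs a function, an upper bound [j.2.1] for it and the exponent [j.2.2] of its
    failure weight; the inequality is the one that [bernstein_points] delivers. *)
Definition passes (R : realType) (T : Type) (E : expectation R T) (th : R)
    (X : seq T) (j : (T -> R) * (R * R)) : Prop :=
  `|\sum_(x <- X) j.1 x - (size X)%:R * ev E j.1| <=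
    2 * th * (size X)%:R * ev E j.1 + j.2.1 * j.2.2 / th.

(* Fine enough for the net errors of all the levels to sum to at most
   [eps / 16 * `|f x| `^ p]. *)
Definition mesh (R : realType) (p eps : R) : R := eps / 16 / (4 * p * 4 `^ p).

Lemma mesh_gt0 (R : realType) (p eps : R) : 1 < p -> 0 < eps -> 0 < mesh p eps.
Proof.
move=> p1 e0; rewrite /mesh divr_gt0//; first lra.
by rewrite mulr_gt0 ?powR_gt0//; lra.
Qed.

Lemma mesh_le (R : realType) (p eps : R) : 1 < p -> 0 < eps < 1 -> mesh p eps <= 4^-1.
Proof.
move=> p1 /andP[e0 e1]; have p4 : 1 <= 4 `^ p :> R.
  by have : 4 <= 4 `^ p :> R; [apply: le1r_powR|]; lra.
rewrite /mesh ler_pdivrMr; [nra|rewrite mulr_gt0//; nra].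
Qed.

Section Levels.
Context (R : realType) (T : Type) (E : expectation R T) (L : set (T -> R)).
Context (p eps A : R) (n : nat) (G : nat -> seq (T -> R)) (a : nat -> R).
Hypotheses (p1 : 1 < p) (eps01 : 0 < eps < 1) (A1 : 1 <= A).
Hypotheses (Ldom : forall f, L f -> dom E f).
Hypothesis Llin : lin_closed L.
Hypothesis nikL : nikolskii E L p A.

Let kap : R := eps / 16.
Let K : R := A `^ p^-1.
Let t (l : nat) : R := K / 2 ^+ l.

Hypothesis tn : t n `^ p <= kap.
Hypothesis covG : forall l, (l < n)%N -> covers E L p (mesh p eps * t l) (G l).
Hypothesis domG : forall l g, (l < n)%N -> g \in G l -> dom E g.
Hypothesis sizeG : forall l, (l < n)%N -> (size (G l))%:R <= expR (a l).

(** In the exponent, [a l] pays for the cardinality of the net at level [l], and [l + 4] makes the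
    weights of the levels a convergent series. *)
Definition level_tests : seq ((T -> R) * (R * R)) :=
  [seq ((fun x => level_powR p (t l) (g x)), (t l `^ p, a l + (l + 4)%:R))
    | l <- iota 0 n, g <- G l].

Let p0 : 0 < p. Proof. exact: lt_trans p1. Qed.
Let kap0 : 0 < kap. Proof. by have /andP[e0 e1] := eps01; rewrite /kap; lra. Qed.
Let kap16 : kap < 16^-1. Proof. by have /andP[e0 e1] := eps01; rewrite /kap; lra. Qed.
Let K0 : 0 < K. Proof. by apply: powR_gt0; exact: lt_le_trans A1. Qed.
Let t0 l : 0 < t l. Proof. by rewrite divr_gt0// exprn_gt0. Qed.

Let dompow f : L f -> dom E (fun x => `|f x| `^ p).
Proof. by move=> Lf; apply: dom_powR => //; exact: Ldom. Qed.

Lemma level_testsP j : j \in level_tests ->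
  [/\ dom E j.1, 0 < j.2.1 & forall x, 0 <= j.1 x <= j.2.1].
Proof.
move=> /allpairsPdep[l [g [ln gG ->]]] /=.
rewrite mem_iota add0n in ln; split.
- by apply: dom_level => //; [exact: ltW|exact: domG ln gG].
- exact: powR_gt0.
- by move=> x; rewrite level_powR_ge0 ?level_powR_le// ltW.
Qed.

(** The net sizes cancel against [expR (- a l)], and [expR (-1) <= 1 / 2] leaves a geometric series.
    A total of a quarter leaves room for two families of tests in one sample. *)
Lemma level_tests_weight : \sum_(j <- level_tests) 2 * expR (- j.2.2) <= 4^-1.
Proof.
rewrite /level_tests big_allpairs_dep.
apply: (@le_trans _ _ (\sum_(l <- iota 0 n) 2 * 2^-1 ^+ (l + 4))).
  rewrite !big_seq; apply: ler_sum => l; rewrite mem_iota add0n => /= ln.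
  rewrite big_const_seq count_predT iter_addr addr0 -[leLHS]mulr_natr -mulrA ler_wpM2l//.
  rewrite opprD expRD mulrC mulrA -[leRHS]mul1r ler_pM ?mulr_ge0 ?expR_ge0//.
    by rewrite expRN ler_pdivrMr ?expR_gt0// mul1r sizeG.
  rewrite expRN -[(l + 4)%:R]mulr1 expRM_natl -exprVn lerXn2r ?nnegrE ?invr_ge0 ?expR_ge0//.
  rewrite lef_pV2 ?posrE ?expR_gt0//.
  by have := expR_ge1Dx (1 : R); lra.
suff -> : \sum_(l <- iota 0 n) 2 * 2^-1 ^+ (l + 4) = 4^-1 * (1 - 2^-1 ^+ n) :> R.
  by have : 0 <= (2^-1 : R) ^+ n by []; lra.
elim: n => [|k IH]; first by rewrite big_nil expr0 subrr mulr0.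
by rewrite -addn1 iotaD big_cat /= IH big_seq1 add0n !exprD; field.
Qed.

Lemma level_tests_unit (m : nat) (X : seq T) f : size X = m -> (0 < m)%N ->
  \sum_(l < n) t l `^ p * (a l + (l + 4)%:R) <= kap ^+ 2 / 2 * m%:R ->
  (forall j, j \in level_tests -> `|\sum_(x <- X) j.1 x - m%:R * ev E j.1| <=
     2 * (kap / 2) * m%:R * ev E j.1 + j.2.1 * j.2.2 / (kap / 2)) ->
  L f -> ev E (fun y => `|f y| `^ p) = 1 ->
  `|\sum_(x <- X) `|f x| `^ p - m%:R| <= eps * m%:R.
Proof.
move=> Xm m0 Hm Hpass Lf f1; have df := Ldom Lf.
have fK x : `|f x| <= K.
  have := nikL x Lf; rewrite f1 mulr1 => H.
  rewrite -[leLHS]powRr1// -(@mulfV _ p) ?gt_eqF// powRrM.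
  by apply: ge0_ler_powR; rewrite ?nnegrE ?invr_ge0 ?(ltW p0) ?powR_ge0 ?(le_trans ler01 A1).
pose phi l x := level_powR p (t l) (f x).
(* [psi l] is the net error allowed by [level_powR_dist]. These layers of [4 * f] sum to at most
   [kap * |f|^p], by the choice of [mesh]. *)
pose psi l x := 4 * p * mesh p eps * level_powR p (t l) (4 * f x).
have dphi l : dom E (phi l) by apply: dom_level => //; exact: ltW.
have dpsi l : dom E (psi l) by apply/domZ/dom_level => //; [exact: ltW|exact: domZ].
have kapE : 4 * p * mesh p eps * 4 `^ p = kap.
  rewrite /mesh -/kap; field.
  by rewrite !gt_eqF ?powR_gt0.
have md0 : 0 <= 4 * p * mesh p eps.
  have /andP[e0 _] := eps01.
  exact: mulr_ge0 (mulr_ge0 (ler0n _ 4) (ltW p0)) (ltW (mesh_gt0 p1 e0)).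
have sumpsi x : \sum_(l < n) psi l x <= kap * `|f x| `^ p.
  rewrite -mulr_sumr sum_level_powR -kapE -[leRHS]mulrA ler_wpM2l//.
  have -> : 4 `^ p * `|f x| `^ p = `|4 * f x| `^ p by rewrite normrM powRM// ger0_norm.
  apply: le_trans (trunc_powR_le_norm (4 * f x) (ltW p0) (ltW K0)).
  by rewrite gerBl trunc_powR_ge0.
have Epsi : \sum_(l < n) ev E (psi l) <= kap.
  rewrite -ev_sum// -[leRHS]mulr1 -f1 -evZ; last exact: dompow.
  by apply: ev_le => //; [exact: dom_sum|exact/domZ/dompow].
have sumphi x : \sum_(l < n) phi l x = `|f x| `^ p - trunc_powR p (t n) (f x).
  by rewrite sum_level_powR trunc_powR_id.
have dtr : dom E (fun x => trunc_powR p (t n) (f x)).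
  by apply: (@dom_comp _ _ E (trunc_powR p _)) => //; apply: continuous_trunc_powR => //; exact: ltW.
have Ephi : \sum_(l < n) ev E (phi l) = 1 - ev E (fun x => trunc_powR p (t n) (f x)).
  rewrite -ev_sum// -f1 -evB//; last exact: dompow.
  by apply: ev_ext.
have tr0 x : 0 <= trunc_powR p (t n) (f x) <= kap.
  by rewrite trunc_powR_ge0 (le_trans (trunc_powR_le _ (ltW p0) (ltW (t0 n)))).
have Etr0 : 0 <= ev E (fun x => trunc_powR p (t n) (f x)) by apply: ev_ge0 => // x; have /andP[] := tr0 x.
have Etr1 : ev E (fun x => trunc_powR p (t n) (f x)) <= kap.
  by rewrite -(ev_cst E kap); apply: ev_le => // [|x]; [exact: dom_cst|have /andP[] := tr0 x].
pose S := \sum_(x <- X) `|f x| `^ p.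
have level l : (l < n)%N -> `|\sum_(x <- X) phi l x - m%:R * ev E (phi l)| <=
    \sum_(x <- X) psi l x + m%:R * ev E (psi l)
    + kap * m%:R * (ev E (phi l) + ev E (psi l))
    + t l `^ p * (a l + (l + 4)%:R) / (kap / 2).
  move=> ln; have [|g gG fg] := covG ln Lf; first by rewrite f1.
  pose h x := level_powR p (t l) (g x).
  have dh : dom E h by apply: dom_level => //; [exact: ltW|exact: domG ln gG].
  have hphi x : `|phi l x - h x| <= psi l x.
    by apply: level_powR_dist => //; exact: mesh_le.
  have hphi1 x : h x <= phi l x + psi l x by have := hphi x; rewrite ler_norml; lra.
  have hphi2 x : phi l x <= h x + psi l x by have := hphi x; rewrite ler_norml; lra.
  have E1 : ev E h <= ev E (phi l) + ev E (psi l).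
    by rewrite -evD//; apply: ev_le => //; exact: domD.
  have E2 : ev E (phi l) <= ev E h + ev E (psi l).
    by rewrite -evD//; apply: ev_le => //; exact: domD.
  have S1 : \sum_(x <- X) h x <= \sum_(x <- X) phi l x + \sum_(x <- X) psi l x.
    by rewrite -big_split; apply: ler_sum.
  have S2 : \sum_(x <- X) phi l x <= \sum_(x <- X) h x + \sum_(x <- X) psi l x.
    by rewrite -big_split; apply: ler_sum.
  have jin : (h, (t l `^ p, a l + (l + 4)%:R)) \in level_tests.
    by apply/allpairsPdep; exists l, g; rewrite mem_iota add0n.
  have := Hpass _ jin; rewrite /=.
  have -> : 2 * (kap / 2) = kap by field.
  rewrite !ler_norml; set B := _ / (kap / 2) => /andP[H1 H2].
  have mR : 0 <= m%:R :> R by [].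
  have M1 := ler_wpM2l mR E1; have M2 := ler_wpM2l mR E2.
  have M3 := ler_wpM2l (ltW kap0) M1.
  lra.
have lowS : 0 <= S - \sum_(l < n) \sum_(x <- X) phi l x <= m%:R * kap.
  rewrite exchange_big /= -sumrB; apply/andP; split.
    by apply: sumr_ge0 => x _; rewrite sumphi; have := tr0 x; lra.
  rewrite -Xm -sum1_size natr_sum mulr_suml; apply: ler_sum => x _.
  by rewrite sumphi mul1r; have := tr0 x; lra.
(* The four terms are the net error on the sample, the net error in mean, the relative deviation of
   the tests, and the additive Bernstein terms bounded through the hypothesis on [m]. *)
have main : `|\sum_(l < n) \sum_(x <- X) phi l x - m%:R * \sum_(l < n) ev E (phi l)| <=
    kap * S + m%:R * kap + kap * m%:R * (1 + kap) + kap * m%:R.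
  rewrite mulr_sumr -sumrB; apply: (le_trans (ler_norm_sum _ _ _)).
  apply: le_trans; first by apply: ler_sum => l _; exact: (level l (ltn_ord l)).
  rewrite !big_split /= -!mulr_sumr -mulr_suml big_split /= Ephi exchange_big /=.
  have -> : kap * m%:R = (kap ^+ 2 / 2 * m%:R) / (kap / 2).
    by field; rewrite gt_eqF.
  apply: lerD; last by rewrite ler_wpM2r// invr_ge0 divr_ge0// ltW.
  have -> : (kap ^+ 2 / 2 * m%:R) / (kap / 2) = kap * m%:R.
    by field; rewrite gt_eqF.
  have km0 : 0 <= kap * m%:R by exact: mulr_ge0 (ltW kap0) _.
  apply: lerD; last by apply: (ler_wpM2l km0); lra.
  apply: lerD; last by rewrite ler_wpM2l.
  by rewrite /S mulr_sumr; apply: ler_sum => x _; exact: sumpsi.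
have m1 : 0 < m%:R :> R by rewrite ltr0n.
rewrite Ephi in main; rewrite -/S ler_norml.
move: main; rewrite ler_norml; set Q := \sum_(l < n) _ in lowS * => main.
set Z := ev E _ in Etr0 Etr1 main.
have mZ0 : 0 <= m%:R * Z by rewrite mulr_ge0 ?(ltW m1).
have mZ1 : m%:R * Z <= m%:R * kap by rewrite ler_wpM2l ?(ltW m1).
have epsE : eps = 16 * kap by rewrite /kap; field.
have km : 0 < kap * m%:R by rewrite mulr_gt0.
have k2m : kap * m%:R * kap <= kap * m%:R * 16^-1 by rewrite ler_wpM2l ?(ltW km) ?(ltW kap16).
have S0 : 0 <= S by apply: sumr_ge0 => x _; exact: powR_ge0.
have kS : kap * S <= 16^-1 * S by rewrite ler_wpM2r// ltW.
have k16m : kap * m%:R <= 16^-1 * m%:R by rewrite ler_wpM2r// ltW.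
(* The sum [S] occurs in its own error term. Since [kap < 1 / 16] it is first absorbed, giving this
   crude bound, which is then put back into the error. *)
have S2 : S <= 2 * m%:R by lra.
have : kap * S <= kap * (2 * m%:R) by rewrite ler_wpM2l// ltW.
rewrite epsE; lra.
Qed.

(** By homogeneity it suffices to treat norm one. A function of norm zero vanishes everywhere by the
    Nikolskii inequality, so its sample sum is zero too. *)
Lemma level_tests_points (X : seq T) : (0 < size X)%N ->
  \sum_(l < n) t l `^ p * (a l + (l + 4)%:R) <= kap ^+ 2 / 2 * (size X)%:R ->
  (forall j, j \in level_tests -> passes E (kap / 2) X j) ->
  discretizes E L p eps X.
Proof.
move=> m0 Hm Hpass f Lf.
set e := ev E _; have e0 : 0 <= e.
  by apply: ev_ge0 => [|x]; [exact: dompow|exact: powR_ge0].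
have [e_eq0|e_neq0] := eqVneq e 0.
  rewrite e_eq0 !mulr0 subr0 big1 ?normr0// => x _.
  by apply/eqP; rewrite eq_le powR_ge0 andbT; have := nikL x Lf; rewrite -/e e_eq0 mulr0.
have {e_neq0}e0 : 0 < e by rewrite lt0r e_neq0.
pose c := e `^ (- p^-1).
have cE x : `|c * f x| `^ p = e^-1 * `|f x| `^ p.
  rewrite normrM powRM// ger0_norm ?powR_ge0// -powRrM mulNr mulVf ?gt_eqF//.
  by rewrite powR_inv1// ltW.
have cE' : (fun x => `|c * f x| `^ p) = (fun x => e^-1 * `|f x| `^ p).
  by apply/funext.
have := level_tests_unit erefl m0 Hm Hpass (lin_scale c Llin Lf).
rewrite cE' evZ ?mulVf ?gt_eqF//; last exact: dompow.
move=> /(_ erefl); under eq_bigr do rewrite cE.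
rewrite -mulr_sumr -(ler_pM2l e0) -[X in X * `|_|]gtr0_norm// -normrM mulrBr.
by rewrite mulrA mulfV ?gt_eqF// mul1r (mulrC e (size X)%:R) (mulrC e (eps * _)).
Qed.

End Levels.

(** * Nets on finite sets *)

(** With [S] the supremum of [|f|], the pointwise bound [|f|^a <= S^(a-b) * |f|^b] and the
    hypothesis give [S^a <= A * S^(a-b) * ev |f|^b]. Boundedness of [f] makes [S] finite, so
    [S^(a-b)] cancels unless [S = 0]. *)
Lemma nikolskii_le (R : realType) (T : Type) (E : expectation R T)
    (L : set (T -> R)) (a b A : R) :
  1 < b -> b <= a -> 0 <= A -> (forall f, L f -> dom E f) ->
  nikolskii E L a A -> nikolskii E L b A.
Proof.
move=> b1 ba A0 Ldom nik f x Lf.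
have df := Ldom _ Lf; have a1 : 1 < a by lra.
have a0 : 0 < a by lra.
have b0 : 0 < b by lra.
have [M fM] := dom_bounded df.
pose V := [set `|f y| | y in setT].
have supV : has_sup V.
  by split; [exists `|f x|, x|exists M => _ [y _ <-]].
pose S := sup V.
have fS y : `|f y| <= S by apply: ub_le_sup; [exact: supV.2|exists y].
have S0 : 0 <= S by apply: le_trans (fS x).
pose Q := A * ev E (fun y => `|f y| `^ b).
have Q0 : 0 <= Q.
  by apply: mulr_ge0 => //; apply: ev_ge0 => [|y]; [exact: dom_powR|exact: powR_ge0].
have key y : `|f y| `^ a <= Q * S `^ (a - b).
  apply: (le_trans (nik f y Lf)); rewrite /Q -mulrA ler_wpM2l// mulrC -evZ; last exact: dom_powR.
  apply: ev_le => [||z]; [exact: dom_powR|exact/domZ/dom_powR|].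
  have -> : `|f z| `^ a = `|f z| `^ (a - b) * `|f z| `^ b.
    by rewrite -powRD subrK// gt_eqF.
  by rewrite ler_wpM2r ?powR_ge0//; apply: ge0_ler_powR; rewrite ?nnegrE// subr_ge0.
have SQ : S `^ a <= Q * S `^ (a - b).
  have P0 : 0 <= Q * S `^ (a - b) by rewrite mulr_ge0 ?powR_ge0.
  rewrite -[leRHS](powRr1 P0) -(@mulVf _ a) ?gt_eqF// powRrM.
  apply: ge0_ler_powR; rewrite ?nnegrE ?powR_ge0 ?(ltW a0)//.
  apply: ge_sup; first exact: supV.1.
  move=> _ [y _ <-]; rewrite -[leLHS]powRr1// -(@mulfV _ a) ?gt_eqF// powRrM.
  by apply: ge0_ler_powR; rewrite ?nnegrE ?invr_ge0 ?powR_ge0 ?(ltW a0)//.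
apply: (@le_trans _ _ (S `^ b)); first by apply: ge0_ler_powR; rewrite ?nnegrE ?(ltW b0).
have [->|Sn0] := eqVneq S 0; first by rewrite powR0 ?gt_eqF.
have SP : 0 < S `^ (a - b) by apply: powR_gt0; rewrite lt0r Sn0.
rewrite -(ler_pM2r SP) -powRD; last by rewrite addrC subrK gt_eqF.
by rewrite addrC subrK.
Qed.

Lemma size_flatten_le (I J : eqType) (s : seq I) (F : I -> seq J) (M : nat) :
  (forall i, (size (F i) <= M)%N) -> (size (flatten [seq F i | i <- s]) <= size s * M)%N.
Proof.
by move=> FM; elim: s => //= i s IH; rewrite size_cat mulSn leq_add.
Qed.

Section UniformConvexity.
Context (R : realType) (T : finType) (E : expectation R T) (L : set (T -> R)).
Context (p A t : R).
Hypotheses (p2 : 2 <= p) (A0 : 0 < A) (t0 : 0 < t).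
Hypotheses (Ldom : forall f, L f -> dom E f).
Hypothesis Llin : lin_closed L.
Hypothesis nikL : nikolskii E L p A.

Let gap := (t / 2) `^ p / A.
Let nrm (f : T -> R) := ev E (fun x => `|f x| `^ p).

Let Lmid f g : L f -> L g -> L (fun x => (f x + g x) / 2).
Proof.
move=> Lf Lg; suff -> : (fun x => (f x + g x) / 2) =
    (fun x => 2^-1 * f x + (- 2^-1 * g x + g x)).
  exact: (lin_comb _ Llin Lf (lin_comb _ Llin Lg Lg)).
by apply/funext => x; field.
Qed.

Let Lhalf f g : L f -> L g -> L (fun x => (g x - f x) / 2).
Proof.
move=> Lf Lg; suff -> : (fun x => (g x - f x) / 2) =
    (fun x => - 2^-1 * f x + (- 2^-1 * g x + g x)).
  exact: (lin_comb _ Llin Lf (lin_comb _ Llin Lg Lg)).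
by apply/funext => x; field.
Qed.

(** The half-difference exceeds [t / 2] at the point [i], so the Nikolskii inequality gives it norm
    at least [gap]; Clarkson's inequality, taken in mean, turns this into a gain at the midpoint. *)
Lemma nrm_separated w h i : L w -> L h -> t < `|h i - w i| ->
  2 * nrm (fun x => (w x + h x) / 2) + 2 * gap <= nrm w + nrm h.
Proof.
move=> Lw Lh hw; have p1 : 1 < p by have := p2; lra.
have dn f : L f -> dom E (fun x => `|f x| `^ p).
  by move=> Lf; apply: dom_powR => //; exact: Ldom.
have gapE : gap <= nrm (fun x => (h x - w x) / 2).
  rewrite /gap ler_pdivrMr// [leRHS]mulrC; apply: le_trans (nikL i (Lhalf Lw Lh)).
  have p0 : 0 <= p by lra.
  have t20 : 0 <= t / 2 by rewrite divr_ge0// ltW.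
  apply: ge0_ler_powR; rewrite ?nnegrE//.
  by rewrite /= normrM (@ger0_norm _ 2^-1)// ler_wpM2r// ltW.
suff : nrm (fun x => (w x + h x) / 2) + nrm (fun x => (h x - w x) / 2) <=
    2^-1 * nrm w + 2^-1 * nrm h by lra.
rewrite /nrm -!evZ; [|exact: dn|exact: dn].
rewrite -!evD; [|by apply/domZ/dn|by apply/domZ/dn|by apply/dn/Lmid|by apply/dn/Lhalf].
apply: ev_le.
- by apply: domD; [apply/dn/Lmid|apply/dn/Lhalf].
- by apply: domD; apply/domZ/dn.
by move=> x; have := clarkson_powR (w x) (h x) p2; lra.
Qed.

(* A cover is built by branching: from a function [w] of small norm, a function
   far from [w] at a point lies in one of [2 #|T|] half-spaces, on which uniform
   convexity forces the norm to be larger by [gap]. *)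
Lemma branching_cover (k : nat) (S : set (T -> R)) :
  (forall f, S f -> L f) ->
  (forall f g, S f -> S g -> S (fun x => (f x + g x) / 2)) ->
  (forall f, S f -> 1 - k%:R * gap < nrm f) ->
  exists G : seq (T -> R), (size G <= (2 * #|T|).+1 ^ k)%N /\
    forall f, S f -> nrm f <= 1 -> exists2 g, g \in G & forall x, `|f x - g x| <= t.
Proof.
elim: k S => [|k IH] S SL Smid Slow.
  exists [::]; split => // f /Slow; rewrite mul0r subr0 => ? ?; lra.
(* Without an element of norm at most [1 - k * gap], the set already satisfies the hypothesis for
   [k]. *)
have [[w [Sw wk]]|/forallNP noW] := pselect (exists w, S w /\ nrm w <= 1 - k%:R * gap); last first.
  have [f Sf|G [sG cG]] := IH S SL Smid.
    by rewrite ltNge; apply/negP => H; apply: (noW f).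
  exists G; split => //; apply: leq_trans sG _; exact: leq_pexp2l.
pose H (c : T * bool) := [set h | S h /\ t < (-1) ^+ c.2 * (h c.1 - w c.1)].
have HG (c : T * bool) : exists G : seq (T -> R), (size G <= (2 * #|T|).+1 ^ k)%N /\
    forall f, H c f -> nrm f <= 1 -> exists2 g, g \in G & forall x, `|f x - g x| <= t.
  apply: IH => [f [/SL]//|f g [Sf tf] [Sg tg]|f [Sf tf]].
    split; first exact: Smid.
    rewrite (_ : _ - _ = ((f c.1 - w c.1) + (g c.1 - w c.1)) / 2); last by field.
    rewrite mulrA mulrDr; lra.
  have tn : t < `|f c.1 - w c.1|.
    apply: lt_le_trans tf _; apply: le_trans (ler_norm _) _.
    by rewrite normrM normrX normrN1 expr1n mul1r.
  (* The midpoint stays in [S], so its norm exceeds [1 - (k + 1) * gap]; as [w] has norm at most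
     [1 - k * gap], the norm of [f] exceeds [1 - k * gap]. *)
  have := nrm_separated (SL _ Sw) (SL _ Sf) tn.
  have := Slow _ (Smid _ _ Sw Sf); rewrite -addn1 natrD; lra.
have [G HGG] := choice HG.
exists (w :: flatten [seq G c | c <- enum {: T * bool}]); split.
  rewrite /= expnS mulSn -add1n leq_add ?expn_gt0//.
  apply: leq_trans (size_flatten_le _ (fun c => (HGG c).1)) _.
  by rewrite -cardE card_prod card_bool (mulnC #|T|).
move=> f Sf f1.
have [fw|/existsNP[x /negP]] := pselect (forall x, `|f x - w x| <= t).
  by exists w => //; rewrite mem_head.
rewrite -ltNge => tx.
have [c Hc] : exists c, H c f.
  have [fwx|fwx] := leP 0 (f x - w x).
    by exists (x, false); split; rewrite // expr0 mul1r -[ltRHS]ger0_norm.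
  by exists (x, true); split; rewrite // expr1 mulN1r -[ltRHS]ltr0_norm.
have [g gG fg] := (HGG c).2 f Hc f1.
exists g => //; rewrite inE; apply/orP; right; apply/flatten_mapP.
by exists c => //; rewrite mem_enum.
Qed.

Lemma convex_cover : exists2 G : seq (T -> R),
  (size G)%:R <= expR (ln (2 * #|T|).+1%:R * (1 + A * (2 / t) `^ p)) &
  covers E L p t G.
Proof.
have p1 : 1 < p by have := p2; lra.
have p0 : 0 < p by lra.
have gap0 : 0 < gap by rewrite divr_gt0// powR_gt0// divr_gt0.
have nrm0 f : L f -> 0 <= nrm f.
  by move=> Lf; apply: ev_ge0 => [|x]; [by apply: dom_powR => //; exact: Ldom|exact: powR_ge0].
(* This depth makes [1 - k * gap] negative, so the lower bound required on norms holds on all of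
   [L]. *)
pose k := (Num.truncn gap^-1).+1.
have [//|//|f Lf|G [sG cG]] := @branching_cover k L.
  apply: lt_le_trans (nrm0 _ Lf); rewrite subr_lt0.
  by rewrite -ltr_pdivrMr// div1r truncnS_gt.
exists G => //.
apply: (@le_trans _ _ ((2 * #|T|).+1 ^ k)%:R); first by rewrite ler_nat.
have n0 : 0 < (2 * #|T|).+1%:R :> R by rewrite ltr0n.
rewrite natrX -[X in X ^+ k](lnK n0) -expRM_natl ler_expR mulrC ler_wpM2l//.
  by rewrite ln_ge0// ler1n.
rewrite /k -addn1 natrD addrC lerD2l.
have gV : gap^-1 = A * (2 / t) `^ p.
  have tp : 0 < (t / 2) `^ p by apply: powR_gt0; rewrite divr_gt0.
  rewrite /gap invf_div; congr (_ * _); apply: (mulIf (lt0r_neq0 tp)).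
  rewrite mulVf ?gt_eqF// -powRM ?divr_ge0 ?(ltW t0)//.
  have -> : 2 / t * (t / 2) = 1 by field; rewrite gt_eqF.
  by rewrite powR1.
by rewrite -gV truncn_le invr_ge0 ltW.
Qed.

End UniformConvexity.

(* Two functions of the unit ball of [L^p] at uniform distance at most [4 t] are
   at [L^2]-distance at most [s] with [s ^+ 2 = 16 * t `^ (2 - p)]: a net of mesh
   [2 * t] splits the ball into pieces of [L^2]-balls of radius [s], to which
   [convex_cover] applies with exponent 2. *)
Lemma interpolation_cover (R : realType) (T : finType) (E : expectation R T)
    (L : set (T -> R)) (p A : R) : 1 < p < 2 -> 1 <= A ->
  (forall f, L f -> dom E f) ->
  lin_closed L ->
  nikolskii E L 2 A ->
  forall (j : nat) (t : R), 0 < t -> A `^ p^-1 <= 2 ^+ j * t ->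
  exists2 G : seq (T -> R),
    (size G)%:R <= expR (ln (2 * #|T|).+1%:R * (130 * (A * t `^ (- p)))) &
    covers E L p t G.
Proof.
move=> /andP[p1 p2] A1 Ldom Llin nik2.
have p0 : 0 < p by lra.
have A0 : 0 < A by lra.
have nikp : nikolskii E L p A by apply: nikolskii_le nik2 => //; lra.
have ln0 : 0 <= ln (2 * #|T|).+1%:R :> R by rewrite ln_ge0// ler1n.
(* At a mesh above the sup norm of the unit ball, the zero function alone is a net. *)
have base t : 0 < t -> A `^ p^-1 <= t -> exists2 G : seq (T -> R),
    (size G)%:R <= expR (ln (2 * #|T|).+1%:R * (130 * (A * t `^ (- p)))) &
    covers E L p t G.
  move=> t0 At; exists [:: fun=> 0].
    by apply: le_trans (expR_ge1Dx _); rewrite lerDl !mulr_ge0 ?powR_ge0 ?(ltW A0).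
  move=> f Lf f1; exists (fun=> 0); first by rewrite mem_head.
  move=> x; rewrite subr0; apply: le_trans At.
  rewrite -[leLHS]powRr1// -(@mulfV _ p) ?gt_eqF// powRrM.
  apply: ge0_ler_powR; rewrite ?nnegrE ?invr_ge0 ?powR_ge0 ?(ltW p0) ?(ltW A0)//.
  by apply: (le_trans (nikp _ x Lf)); rewrite -[leRHS]mulr1 ler_wpM2l// ltW.
elim=> [|j IH] t t0 At; first by apply: base => //; rewrite expr0 mul1r in At.
have [/base/(_)|tA] := leP (A `^ p^-1) t; first exact.
have [||G' sG' cG'] := IH (2 * t); [by rewrite mulr_gt0|by rewrite mulrA -exprSr|].
(* Net functions may lie outside [L]. Each is replaced by an element of the unit ball within [2 * t]
   of it, if there is one, which doubles the distance to [4 * t]. *)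
have rep_ex g : exists f, (exists2 f0, L f0 /\ ev E (fun y => `|f0 y| `^ p) <= 1 &
      forall x, `|f0 x - g x| <= 2 * t) ->
    (L f /\ ev E (fun y => `|f y| `^ p) <= 1) /\ (forall x, `|f x - g x| <= 2 * t).
  have [[f0 H1 H2]|H] := pselect (exists2 f0, L f0 /\ ev E (fun y => `|f0 y| `^ p) <= 1 &
      forall x, `|f0 x - g x| <= 2 * t); first by exists f0.
  by exists g => /H.
have [rep repP] := choice rep_ex.
pose s := 4 * t `^ ((2 - p) / 2).
have s0 : 0 < s by rewrite mulr_gt0 ?powR_gt0.
have s2 : s ^+ 2 = 16 * t `^ (2 - p).
  by rewrite exprMn -(powR_mulrn 2 (powR_ge0 _ _)) -powRrM divfK//; congr (_ * _); ring.
have [H sH cH] := convex_cover (lexx 2) A0 (divr_gt0 t0 s0) Ldom Llin nik2.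
exists [seq (fun x => rep g x + s * w x) | g <- G', w <- H].
  (* The constant 130 reproduces itself: doubling the mesh at least halves the first exponent to 65,
     the lone 1 is at most [A * t^(-p)], and the [L^2] net adds 64. *)
  rewrite size_allpairs natrM.
  apply: (@le_trans _ _ (expR (ln (2 * #|T|).+1%:R * (130 * (A * (2 * t) `^ (- p)))) *
      expR (ln (2 * #|T|).+1%:R * (1 + A * (2 / (t / s)) `^ 2)))); first exact: ler_pM.
  rewrite -expRD ler_expR -mulrDr ler_wpM2l//.
  have tp0 : 0 < t `^ p by apply: powR_gt0.
  have -> : (2 / (t / s)) `^ 2 = 64 * t `^ (- p).
    have -> : 2 / (t / s) = 2 * s / t by field; rewrite !gt_eqF.
    rewrite powR_mulrn; last exact: ltW (divr_gt0 (mulr_gt0 (ltr0Sn _ 1) s0) t0).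
    rewrite exprMn exprMn s2 powRB; last by rewrite gt_eqF// implybT.
    rewrite powR_mulrn ?(ltW t0)// powRN; field.
    by rewrite !gt_eqF.
  have h2 : (2 * t) `^ (- p) <= 2^-1 * t `^ (- p).
    rewrite powRM ?(ltW t0)// ler_wpM2r ?powR_ge0// powRN lef_pV2 ?posrE ?powR_gt0//.
    by apply: le1r_powR; [rewrite ler1n|exact: ltW].
  have h1 : 1 <= A * t `^ (- p).
    rewrite powRN ler_pdivlMr// mul1r.
    have -> : A = (A `^ p^-1) `^ p by rewrite -powRrM mulVf ?gt_eqF// powRr1// ltW.
    by apply: ge0_ler_powR; rewrite ?nnegrE ?powR_ge0 ?(ltW p0) ?(ltW t0) ?(ltW tA).
  by have := ler_wpM2l (ltW A0) h2; clear -h1; lra.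
move=> f Lf f1; have [g gG' fg] := cG' f Lf f1.
have [[Lr r1] rg] : (L (rep g) /\ ev E (fun y => `|rep g y| `^ p) <= 1) /\
    (forall x, `|rep g x - g x| <= 2 * t) by apply: repP; exists f.
pose u x := s^-1 * (f x - rep g x).
have Ld : L (fun x => f x - rep g x).
  by have := lin_comb (-1) Llin Lr Lf; congr (L _); apply/funext => x; ring.
have Lu : L u.
  exact: lin_scale Llin Ld.
have dp h : L h -> dom E (fun x => `|h x| `^ p).
  by move=> Lh; apply: dom_powR => //; exact: Ldom.
have u1 : ev E (fun y => `|u y| `^ 2) <= 1.
  (* Split the square as a [(2 - p)]-th power, bounded through the uniform distance [4 * t], times a
     [p]-th power, bounded through the norms of [f] and [rep g]. *)
  pose c := s ^- 2 * (4 * t) `^ (2 - p) * 2 `^ p.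
  have c0 : 0 <= c by rewrite !mulr_ge0 ?powR_ge0// invr_ge0 exprn_ge0// ltW.
  apply: (@le_trans _ _ (ev E (fun x => c * (`|f x| `^ p + `|rep g x| `^ p)))).
    apply: ev_le => [||x].
    - by apply: dom_powR; [rewrite ltr1n|exact: Ldom].
    - by apply/domZ/domD; exact: dp.
    have d4 : `|f x - rep g x| <= 4 * t.
      have := ler_distD (g x) (f x) (rep g x); have := fg x; have := rg x.
      by rewrite (distrC (rep g x)); clear; lra.
    rewrite /u normrM powRM// ger0_norm ?invr_ge0 ?(ltW s0)//.
    rewrite powR_mulrn ?invr_ge0 ?(ltW s0)// exprVn /c -!mulrA ler_wpM2l ?invr_ge0 ?exprn_ge0 ?(ltW s0)//.
    have -> : (2 : R) = (2 - p) + p by ring.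
    rewrite powRD; last by rewrite subrK pnatr_eq0.
    rewrite addrK; apply: ler_pM; rewrite ?powR_ge0//.
      by apply: ge0_ler_powR; rewrite ?nnegrE ?mulr_ge0 ?(ltW t0) ?subr_ge0 ?(ltW p2).
    by rewrite subrK; apply: powR_normB.
  rewrite evZ ?evD//; [|exact: dp|exact: dp|by apply: domD; exact: dp].
  apply: (@le_trans _ _ (c * 2)); first by apply: (ler_wpM2l c0); clear -f1 r1; lra.
  have -> : c * 2 = 4 `^ (2 - p) * 2 `^ p * 2 / 16.
    rewrite /c s2 powRM ?(ltW t0)//; field.
    by rewrite gt_eqF// powR_gt0.
  have -> : 4 `^ (2 - p) * 2 `^ p = 2 `^ (4 - p) :> R.
    have -> : 4 `^ (2 - p) = 2 `^ (2 * (2 - p)) :> R.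
      by rewrite powRrM powR_mulrn//; congr (_ `^ _); ring.
    rewrite -powRD; last by rewrite pnatr_eq0 implybT.
    by congr (_ `^ _); ring.
  have : 2 `^ (4 - p) <= 2 `^ 3 :> R.
    by apply: ler_powR; [rewrite ler1n|clear -p1; lra].
  by rewrite powR_mulrn//; clear; lra.
have [w wH uw] := cH u Lu u1.
exists (fun x => rep g x + s * w x).
  by apply/allpairsP; exists (g, w).
move=> x; have -> : f x - (rep g x + s * w x) = s * (u x - w x).
  by rewrite /u; field; rewrite gt_eqF.
by rewrite normrM gtr0_norm// mulrC -ler_pdivlMr.
Qed.

Lemma finite_cover (R : realType) (T : finType) (E : expectation R T)
    (L : set (T -> R)) (p A t : R) : 1 < p -> 1 <= A ->
  (forall f, L f -> dom E f) ->
  lin_closed L ->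
  nikolskii E L (Num.max p 2) A ->
  0 < t -> t `^ p <= A ->
  exists2 G : seq (T -> R),
    (size G)%:R <= expR (ln (2 * #|T|).+1%:R * ((130 + 2 `^ p) * (A * t `^ (- p)))) &
    covers E L p t G.
Proof.
move=> p1 A1 Ldom Llin nik t0 tA.
have A0 : 0 < A by lra.
have ln0 : 0 <= ln (2 * #|T|).+1%:R :> R by rewrite ln_ge0// ler1n.
have At : 1 <= A * t `^ (- p) by rewrite powRN ler_pdivlMr ?powR_gt0// mul1r.
have tp0 := powR_gt0 (- p) t0.
have [p2|p2] := ltP p 2.
  rewrite (max_r (ltW p2)) in nik.
  have p12 : 1 < p < 2 by rewrite p1.
  (* Any number of halvings reaching the trivial mesh will do, because the size bound does not
     depend on it. *)
  pose j := (Num.truncn (A `^ p^-1 / t)).+1.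
  have [|G sG cG] := interpolation_cover p12 A1 Ldom Llin nik (j := j) t0.
    rewrite -ler_pdivrMr//; apply: ltW; apply: lt_trans (truncnS_gt _) _.
    by rewrite -natrX ltr_nat ltn_expl.
  exists G => //; apply: le_trans sG _; rewrite ler_expR; apply: (ler_wpM2l ln0).
  by apply: (ler_wpM2r (le_trans ler01 At)); rewrite lerDl powR_ge0.
rewrite (max_l p2) in nik.
have [G sG cG] := convex_cover p2 A0 t0 Ldom Llin nik.
exists G => //; apply: le_trans sG _; rewrite ler_expR ler_wpM2l//.
rewrite powRM ?invr_ge0 ?(ltW t0)// -(powR_inv1 (ltW t0)) -powRrM mulN1r.
have := mulr_ge0 (powR_ge0 2 p) (ltW (mulr_gt0 A0 tp0)); nra.
Qed.

(** * Parseval frames and grids *)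

Lemma lin_closed_sum (R : realType) (T : Type) (V : set (T -> R)) (N : nat)
    (c : nat -> R) (u : nat -> T -> R) g : lin_closed V -> V g ->
  (forall i, (i < N)%N -> V (u i)) -> V (fun x => \sum_(i < N) c i * u i x + g x).
Proof.
move=> Vlin; elim: N g => [|N IH] g Vg Vu.
  by move: Vg; congr (V _); apply/funext => x; rewrite big_ord0 add0r.
have := IH _ (Vlin (c N) _ _ (Vu N (ltnSn N)) Vg) (fun i iN => Vu i (ltnW iN)).
by congr (V _); apply/funext => x; rewrite big_ord_recr /= addrA.
Qed.

Definition nat_span (R : realType) (T : Type) (N : nat) (e : nat -> T -> R) :=
  [set f : T -> R | exists c : nat -> R, forall x, f x = \sum_(i < N) c i * e i x].

Lemma nat_span_lin (R : realType) (T : Type) (N : nat) (e : nat -> T -> R) :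
  lin_closed (nat_span N e).
Proof.
move=> a f g [c fc] [d gd]; exists (fun i => a * c i + d i) => x.
rewrite fc gd mulr_sumr -big_split; apply: eq_bigr => i _ /=; ring.
Qed.

Lemma nat_span_mem (R : realType) (T : Type) (N : nat) (e : nat -> T -> R) i :
  (i < N)%N -> nat_span N e (e i).
Proof.
move=> iN; exists (fun j => (j == i)%:R) => x.
rewrite (bigD1 (Ordinal iN))//= eqxx mul1r big1 ?addr0// => j ji.
by rewrite (_ : (j : nat) == i = false) ?mul0r//; apply: negbTE.
Qed.

Lemma nat_spanS (R : realType) (T : Type) (N : nat) (e : nat -> T -> R) f :
  nat_span N e f -> nat_span N.+1 e f.
Proof.
move=> [c fc]; exists (fun j => if (j < N)%N then c j else 0) => x.
rewrite big_ord_recr /= ltnn mul0r addr0 fc.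
by apply: eq_bigr => i _; rewrite ltn_ord.
Qed.

Section Frame.
Context (R : realType) (T : Type) (E : expectation R T) (L : set (T -> R)) (A : R).
Hypothesis Ldom : forall f, L f -> dom E f.
Hypothesis Llin : lin_closed L.
Hypothesis nik2 : forall f x, L f -> f x ^+ 2 <= A * ev E (fun y => f y ^+ 2).

Definition inner_ev (f g : T -> R) := ev E (fun x => f x * g x).
Local Notation ip := inner_ev.

Let ip_lin a f g h : L f -> L g -> L h ->
  ip (fun x => a * f x + g x) h = a * ip f h + ip g h.
Proof.
move=> Lf Lg Lh; have df := Ldom Lf; have dg := Ldom Lg; have dh := Ldom Lh.
rewrite /ip -ev_lin; [|exact: domM|exact: domM].
by apply: ev_ext => x; ring.
Qed.

Let ip_sum f (N : nat) (c : nat -> R) (u : nat -> T -> R) g :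
  L g -> (forall i, (i < N)%N -> L (u i)) ->
  (forall x, f x = \sum_(i < N) c i * u i x) ->
  ip f g = \sum_(i < N) c i * ip (u i) g.
Proof.
move=> Lg Lu fE; have dug (i : 'I_N) : dom E (fun x => u i x * g x).
  by apply: domM; [exact/Ldom/Lu|exact: Ldom].
rewrite /ip; under [RHS]eq_bigr do rewrite -evZ//.
rewrite -ev_sum; last by move=> i _; exact: domZ.
by apply: ev_ext => x; rewrite fE mulr_suml; apply: eq_bigr => i _; rewrite mulrA.
Qed.

Let ipC f g : ip f g = ip g f.
Proof. by apply: ev_ext => x; rewrite mulrC. Qed.

(* Gram-Schmidt; a vector whose orthogonalisation vanishes yields [u i = 0]. *)
Lemma parseval_frame (N : nat) (e : nat -> T -> R) :
  (forall i, (i < N)%N -> L (e i)) ->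
  exists u : nat -> T -> R,
    (forall i, (i < N)%N -> [/\ L (u i), ip (u i) (u i) <= 1 & nat_span N e (u i)]) /\
    (forall f, nat_span N e f -> forall x, f x = \sum_(i < N) ip f (u i) * u i x).
Proof.
elim: N => [|N IH] Le.
  by exists (fun=> fun=> 0); split => // f [c fc] x; rewrite fc !big_ord0.
have [u [uP frame]] := IH (fun i iN => Le i (ltnW iN)).
have Lu i : (i < N)%N -> L (u i) by case/uP.
have LeN : L (e N) by exact: Le.
pose a i := ip (e N) (u i).
pose r x := \sum_(i < N) (- a i) * u i x + e N x.
have Lr : L r by exact: (@lin_closed_sum _ _ L N (fun i => - a i) u (e N) Llin LeN Lu).
have spanL g : nat_span N e g -> L g.
  move=> [c gc].
  have L0 : L (fun x => -1 * e N x + e N x) by exact: lin_comb.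
  have := @lin_closed_sum _ _ _ N c e _ Llin L0 (fun i iN => Le i (ltnW iN)).
  by congr (L _); apply/funext => x; rewrite gc; ring.
(* Expanding [g] in the frame, the terms [ip g (u i) * a i] from [e N] and from its subtracted
   projection cancel. *)
have orth g : nat_span N e g -> ip g r = 0.
  move=> Sg; have Lg := spanL g Sg.
  pose S x := \sum_(i < N) (- a i) * u i x.
  have rE : r = (fun x => 1 * e N x + (-1 * e N x + (\sum_(i < N) (- a i) * u i x + e N x))).
    by apply/funext => x; rewrite /r; ring.
  have SE : (fun x => \sum_(i < N) - a i * u i x) = (fun x => -1 * e N x + r x).
    by apply/funext => x; rewrite /r; ring.
  have LS : L S by rewrite /S SE; exact: lin_comb.
  have -> : ip g r = ip (fun x => 1 * S x + e N x) g.
    by rewrite ipC; congr (ip _ g); apply/funext => x; rewrite /r /S mul1r.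
  rewrite ip_lin// mul1r (@ip_sum S N (fun i => - a i) u g)//.
  rewrite (ipC (e N)) (@ip_sum g N (fun i => ip g (u i)) u (e N))//; last exact: frame.
  rewrite -big_split big1//= => i _; rewrite (ipC (u i) g) (ipC (u i)) /a; ring.
pose n2 := ip r r; pose s := Num.sqrt n2; pose v x := s^-1 * r x.
have n20 : 0 <= n2.
  by apply: ev_ge0 => [|x]; [by apply: domM; exact: Ldom|rewrite -expr2 sqr_ge0].
have s2 : s ^+ 2 = n2 by rewrite sqr_sqrtr.
have Lv : L v.
  exact: lin_scale Llin Lr.
(* If [s = 0], its inverse is 0 by convention, and the Nikolskii inequality forces [r x = 0], so the
   identity persists. *)
have vr x : s^-1 * n2 * v x = r x.
  rewrite /v -s2; have [s0|s0] := eqVneq s 0; last by field.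
  have := nik2 x Lr; rewrite (_ : ev E _ = n2); last first.
    by apply: ev_ext => y; rewrite expr2.
  rewrite -s2 s0 expr0n mulr0 => r0; rewrite invr0 !mul0r; apply/esym/eqP.
  by rewrite -sqrf_eq0 eq_le r0 sqr_ge0.
have ipv g : L g -> ip g v = s^-1 * ip g r.
  move=> Lg; rewrite /ip -evZ; last by apply: domM; exact: Ldom.
  by apply: ev_ext => x; rewrite /v mulrCA.
have Sr : nat_span N.+1 e r.
  apply: (@lin_closed_sum _ _ _ N (fun i => - a i) u (e N));
    [exact: nat_span_lin|exact: nat_span_mem|].
  by move=> i /uP[_ _]; exact: nat_spanS.
exists (fun i => if (i < N)%N then u i else v); split.
  move=> i; rewrite ltnS leq_eqVlt => /predU1P[->|iN]; last first.
    by rewrite iN; case: (uP i iN) => ? ? /nat_spanS.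
  rewrite ltnn; split => //.
    rewrite ipv// ipC ipv// -/n2 -s2.
    have [->|s0] := eqVneq s 0; first by rewrite invr0 mul0r.
    by rewrite le_eqVlt; apply/orP; left; apply/eqP; field.
  exact: lin_scale (@nat_span_lin _ _ _ _) Sr.
move=> f [c fc] x; rewrite big_ord_recr /= ltnn.
pose g y := \sum_(i < N) c N * a i * u i y + \sum_(i < N) c i * e i y.
have Sg : nat_span N e g.
  apply: (@lin_closed_sum _ _ _ N (fun i => c N * a i) u) => //.
  - exact: nat_span_lin.
  - by exists c.
  - by move=> i /uP[].
have fE : f = (fun y => c N * r y + g y).
  apply/funext => y; rewrite fc big_ord_recr /= /r /g.
  have -> : \sum_(i < N) c N * a i * u i y = c N * \sum_(i < N) a i * u i y.
    by rewrite mulr_sumr; apply: eq_bigr => i _; rewrite mulrA.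
  have -> : \sum_(i < N) - a i * u i y = - \sum_(i < N) a i * u i y.
    by rewrite -sumrN; apply: eq_bigr => i _; rewrite mulNr.
  ring.
have Lg := spanL _ Sg.
have ipfu (i : 'I_N) : ip f (u i) = ip g (u i).
  have [Lui _ Sui] := uP i (ltn_ord i).
  by rewrite fE ip_lin// (ipC r) orth// mulr0 add0r.
under eq_bigr do rewrite ltn_ord ipfu.
have fx : f x = c N * r x + g x by rewrite {1}fE.
have ipfv : ip f v = s^-1 * (c N * n2).
  by rewrite fE ip_lin// !ipv// (orth _ Sg) mulr0 addr0 -/n2 mulrCA.
by rewrite -frame// fx ipfv addrC -vr; congr (_ + _); ring.
Qed.

End Frame.

(** Frame coefficients of the unit ball lie in [[- A^2, A^2]] and the frame functions are bounded by
    [A]. Rounding each coefficient down to a grid of step [d / (N * A)] therefore moves a function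
    by at most [d]. *)
Lemma grid_cover (R : realType) (T : Type) (E : expectation R T)
    (L : set (T -> R)) (p A d : R) (N : nat) (e : nat -> T -> R) :
  1 < p -> 1 <= A -> 0 < d -> (0 < N)%N ->
  (forall f, L f -> dom E f) -> lin_closed L ->
  (forall i, (i < N)%N -> L (e i)) -> (forall f, L f -> nat_span N e f) ->
  nikolskii E L p A -> nikolskii E L 2 A ->
  exists G : seq (T -> R),
    [/\ (size G)%:R <= expR (2 * A ^+ 3 * N%:R ^+ 2 / d),
        forall g, g \in G -> dom E g & covers E L p d G].
Proof.
move=> p1 A1 d0 N0 Ldom Llin Le spanL nikp nik2.
have A0 : 0 < A by lra.
have NR : 0 < N%:R :> R by rewrite ltr0n.
have pow2 (y : R) : `|y| `^ 2 = y ^+ 2.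
  by rewrite powR_mulrn// real_normK// num_real.
have nik2' f x : L f -> f x ^+ 2 <= A * ev E (fun y => f y ^+ 2).
  move=> Lf; have := nik2 f x Lf; rewrite pow2.
  by rewrite (_ : (fun y => _) = (fun y => f y ^+ 2))//; apply/funext => y; rewrite pow2.
have [u [uP frame]] := parseval_frame Ldom Llin nik2' Le.
have uA i x : (i < N)%N -> `|u i x| <= A.
  move=> /uP[Lu u1 _]; have := nik2' _ x Lu.
  have -> : ev E (fun y => u i y ^+ 2) = inner_ev E (u i) (u i).
    by apply: ev_ext => y; rewrite expr2.
  move=> H; rewrite -(@ler_pXn2r _ 2)// ?nnegrE ?(ltW A0)// real_normK ?num_real//.
  by apply: (le_trans H); nra.
have fA f x : L f -> ev E (fun y => `|f y| `^ p) <= 1 -> `|f x| <= A.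
  move=> Lf f1; rewrite leNgt; apply/negP => Af.
  have fx1 : 1 <= `|f x| by lra.
  have := nikp f x Lf; have := le1r_powR fx1 (ltW p1).
  by move: f1; set q := ev _ _; nra.
pose h := d / (N%:R * A).
have h0 : 0 < h by rewrite divr_gt0// mulr_gt0.
pose B := (Num.truncn (2 * A ^+ 2 / h)).+1.
pose rec (k : {ffun 'I_N -> 'I_B}) (x : T) := \sum_(i < N) (h * (k i)%:R - A ^+ 2) * u i x.
exists [seq rec k | k <- enum {: {ffun 'I_N -> 'I_B}}]; split.
- rewrite size_map -cardE card_ffun !card_ord natrX.
  have -> : 2 * A ^+ 3 * N%:R ^+ 2 / d = N%:R * (2 * A ^+ 2 / h).
    by rewrite /h; field; rewrite !gt_eqF.
  rewrite expRM_natl lerXn2r ?nnegrE ?expR_ge0// /B -addn1 natrD.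
  apply: le_trans (expR_ge1Dx _); rewrite addrC lerD2l truncn_le.
  exact: ltW (divr_gt0 (mulr_gt0 (ltr0Sn _ 1) (exprn_gt0 2 A0)) h0).
- move=> _ /mapP[k _ ->].
  apply: (@dom_sum _ _ _ _ _ (fun i x => (h * (k i)%:R - A ^+ 2) * u i x)) => i _.
  by apply/domZ/Ldom; have [] := uP i (ltn_ord i).
move=> f Lf f1.
have cA (i : 'I_N) : `|inner_ev E f (u i)| <= A ^+ 2.
  have [Lu _ _] := uP i (ltn_ord i).
  have dfu : dom E (fun x => f x * u i x) by apply: domM; exact: Ldom.
  have fu x : `|f x * u i x| <= A ^+ 2 by rewrite normrM expr2; apply: ler_pM => //; [exact: fA|exact: uA].
  rewrite ler_norml; apply/andP; split.
    rewrite -[leLHS](ev_cst E); apply: ev_le => // [|x]; first exact: dom_cst.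
    by have := fu x; rewrite ler_norml => /andP[].
  rewrite -[leRHS](ev_cst E); apply: ev_le => // [|x]; first exact: dom_cst.
  by have := fu x; rewrite ler_norml => /andP[].
pose z (i : 'I_N) := (inner_ev E f (u i) + A ^+ 2) / h.
have z0 i : 0 <= z i.
  by have := cA i; rewrite ler_norml /z => ?; rewrite divr_ge0 ?(ltW h0)//; lra.
have zB i : (Num.truncn (z i) < B)%N.
  rewrite ltnS; apply: le_truncn; rewrite ler_pM2r ?invr_gt0//.
  by have := cA i; rewrite ler_norml; lra.
exists (rec [ffun i => Ordinal (zB i)]); first by apply: map_f; rewrite mem_enum.
move=> x; rewrite (frame f (spanL f Lf)) /rec -sumrB.
apply: le_trans (ler_norm_sum _ _ _) _.
apply: (@le_trans _ _ (\sum_(i < N) h * A)); last first.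
  rewrite sumr_const card_ord -mulr_natr /h le_eqVlt; apply/orP; left; apply/eqP.
  by field; rewrite !gt_eqF.
apply: ler_sum => i _; rewrite -mulrBl normrM ler_pM// ?uA//.
rewrite ffunE /=; have /andP[t1 t2] := truncn_itv (z0 i).
have zE : inner_ev E f (u i) = h * z i - A ^+ 2 by rewrite /z; field; rewrite gt_eqF.
rewrite zE opprB addrA subrK -mulrBr normrM gtr0_norm// -[leRHS]mulr1.
rewrite ler_wpM2l ?(ltW h0)// ger0_norm ?subr_ge0//.
by move: t2; rewrite -addn1 natrD; lra.
Qed.

(** * Two-stage sampling *)

Lemma pow2_between (R : realType) (x : R) : 1 <= x ->
  exists n : nat, x <= 2 ^+ n <= 2 * x.
Proof.
move=> x1; have exn : exists n, x <= 2 ^+ n.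
  exists (Num.truncn x).+1; apply: ltW; apply: lt_trans (truncnS_gt _) _.
  by rewrite -natrX ltr_nat ltn_expl.
have [n xn nmin] := ex_minnP exn; exists n; rewrite xn /=.
case: n xn nmin => [|n] xn nmin; first by rewrite expr0; lra.
rewrite exprS ler_pM2l//; have [//|xn'] := leP (2 ^+ n) x.
by have := nmin n (ltW xn'); rewrite ltnn.
Qed.

Lemma level_pow (R : realType) (p A : R) (l : nat) : 1 < p -> 1 <= A ->
  (A `^ p^-1 / 2 ^+ l) `^ p <= A / 2 ^+ l.
Proof.
move=> p1 A1; have l0 : 0 <= (2 ^+ l)^-1 :> R by rewrite invr_ge0 exprn_ge0.
rewrite powRM ?powR_ge0// -powRrM mulVf ?gt_eqF; [|lra|lra].
rewrite powRr1; last lra.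
rewrite ler_wpM2l//; first lra.
apply: ge1r_powR; last exact: ltW.
by rewrite invr_gt0 exprn_gt0//= invf_le1 ?exprn_gt0// exprn_ege1// ler1n.
Qed.

Lemma level_nat_le (R : realType) (p A : R) (l : nat) : 1 < p -> 1 <= A ->
  (A `^ p^-1 / 2 ^+ l) `^ p * (l + 4)%:R <= 4 * A.
Proof.
move=> p1 A1; apply: (@le_trans _ _ (A / 2 ^+ l * (l + 4)%:R)).
  by rewrite ler_wpM2r// level_pow.
rewrite -mulrA mulrC ler_wpM2r//; first lra.
rewrite mulrC ler_pdivrMr ?exprn_gt0// -natrX -natrM ler_nat.
elim: l => // l IH; rewrite expnS; lia.
Qed.

(** * First stage: a sample of polynomial size *)

Section Coarse.
Context (R : realType) (T : Type) (E : expectation R T) (L : set (T -> R)).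
Context (A : R) (N : nat) (e : nat -> T -> R).
Hypotheses (A1 : 1 <= A) (N0 : (0 < N)%N).
Hypotheses (Ldom : forall f, L f -> dom E f) (Llin : lin_closed L).
Hypotheses (Le : forall i, (i < N)%N -> L (e i)) (spanL : forall f, L f -> nat_span N e f).
Hypothesis nik2 : nikolskii E L 2 A.

(* Only the polynomial growth matters: this quantity enters the final bound
   through its logarithm. *)
Definition coarse_bound (kap d : R) : R :=
  4 * A ^+ 2 / kap ^+ 3 * (4 * A ^+ 4 * N%:R ^+ 2 / (d * kap) + 2 * A / kap + 4).

(** One grid, finer than every level requires, serves all of them, since a polynomial sample size is
    enough here. Tests rather than points are returned so that two exponents can share a sample. *)
Lemma coarse_tests (p eps d : R) (m : nat) : 1 < p -> 0 < eps < 1 ->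
  nikolskii E L p A -> 0 < d -> d <= mesh p eps -> (0 < m)%N ->
  coarse_bound (eps / 16) d <= m%:R ->
  exists js : seq ((T -> R) * (R * R)),
    [/\ forall j, j \in js -> [/\ dom E j.1, 0 < j.2.1 & forall x, 0 <= j.1 x <= j.2.1],
        \sum_(j <- js) 2 * expR (- j.2.2) <= 4^-1 &
        forall X, size X = m -> (forall j, j \in js -> passes E (eps / 16 / 2) X j) ->
          discretizes E L p eps X].
Proof.
move=> p1 eps01 nikp d0 dm m0 mb.
set kap := eps / 16 in mb *.
have /andP[e0 e1] := eps01.
have kap0 : 0 < kap by rewrite /kap; lra.
have kap1 : kap <= 1 by rewrite /kap; lra.
have A0 : 0 < A by apply: lt_le_trans A1.
have [|n /andP[n1 n2]] := @pow2_between R (A / kap).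
  by rewrite ler_pdivlMr// mul1r (le_trans kap1).
have pn0 : 0 < 2 ^+ n :> R by rewrite exprn_gt0.
have [G [sG dG cG]] := grid_cover p1 A1 (divr_gt0 d0 pn0) N0 Ldom Llin Le spanL nikp nik2.
pose a := 2 * A ^+ 3 * N%:R ^+ 2 / (d / 2 ^+ n).
have a0 : 0 <= a.
  rewrite /a; apply: divr_ge0; last exact: ltW (divr_gt0 d0 pn0).
  by rewrite !mulr_ge0 ?exprn_ge0// ltW.
have covG (l : nat) : (l < n)%N -> covers E L p (mesh p eps * (A `^ p^-1 / 2 ^+ l)) G.
  move=> ln f Lf f1; have [g gG fg] := cG f Lf f1; exists g => // x.
  apply: (le_trans (fg x)); apply: ler_pM => //; first exact: ltW.
  rewrite -[leLHS]mul1r; apply: ler_pM => //.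
    have : 1 `^ p^-1 <= A `^ p^-1.
      apply: ge0_ler_powR; rewrite ?nnegrE ?(ltW A0)//.
      by rewrite invr_ge0; lra.
    by rewrite powR1.
  by rewrite lef_pV2 ?posrE ?exprn_gt0// ler_eXn2l ?ltr1n// ltnW.
exists (level_tests p A n (fun=> G) (fun=> a)); split.
- by move=> j; apply: level_testsP => // l g _; exact: dG.
- by apply: level_tests_weight => l _.
move=> X Xm HX.
apply: (@level_tests_points _ _ E L p eps A n (fun=> G) (fun=> a)) => //; rewrite ?Xm//.
- apply: (le_trans (level_pow n p1 A1)).
  by rewrite ler_pdivrMr// mulrC -ler_pdivrMr.
- by move=> l g _; exact: dG.
apply: (@le_trans _ _ (\sum_(l < n) A * (a + 2 * A / kap + 4))).
  apply: ler_sum => l _; apply: ler_pM.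
  - exact: powR_ge0.
  - by rewrite addr_ge0.
  - apply: (le_trans (level_pow l p1 A1)).
    by rewrite ler_pdivrMr ?exprn_gt0// ler_peMr// ?(ltW A0)// exprn_ege1// ler1n.
  rewrite natrD addrA lerD2r lerD2l -mulrA; apply: le_trans n2.
  by rewrite -natrX ler_nat; apply: ltnW; apply: ltn_trans (ltn_ord l) (ltn_expl _ _).
rewrite sumr_const card_ord -[leLHS]mulr_natr.
have nA : n%:R <= 2 * A / kap.
  rewrite -mulrA; apply: le_trans n2; rewrite -natrX ler_nat; exact: ltnW (ltn_expl _ _).
have Ak : 0 <= 2 * A / kap := ltW (divr_gt0 (mulr_gt0 (ltr0Sn _ 1) A0) kap0).
have c0 : 0 <= A * (a + 2 * A / kap + 4).
  by apply: mulr_ge0; [exact: ltW|lra].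
apply: (le_trans (ler_wpM2l c0 nA)).
have aE : a <= 4 * A ^+ 4 * N%:R ^+ 2 / (d * kap).
  have -> : 4 * A ^+ 4 * N%:R ^+ 2 / (d * kap) = 2 * A ^+ 3 * N%:R ^+ 2 / d * (2 * (A / kap)).
    by field; rewrite !gt_eqF.
  have -> : a = 2 * A ^+ 3 * N%:R ^+ 2 / d * 2 ^+ n by rewrite /a invf_div (mulrC (2 ^+ n)) mulrA.
  apply: ler_wpM2l => //.
  by apply: divr_ge0 (ltW d0); rewrite !mulr_ge0 ?exprn_ge0// ltW.
move: mb; rewrite /coarse_bound; set V := _ / (d * kap) in aE * => mb.
have k2 : 0 <= kap ^+ 2 / 2 by rewrite divr_ge0// exprn_ge0// ltW.
apply: le_trans (ler_wpM2l k2 mb).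
have -> : kap ^+ 2 / 2 * (4 * A ^+ 2 / kap ^+ 3 * (V + 2 * A / kap + 4)) =
    A * (V + 2 * A / kap + 4) * (2 * A / kap) by field; rewrite gt_eqF.
rewrite (ler_wpM2r Ak)//.
by rewrite ler_wpM2l ?(ltW A0)//; lra.
Qed.

(** The two families of tests have total weight at most a half, so one sample passes both. The
    exponent [p] is the one to discretize; the other, [Num.max p 2], carries the Nikolskii
    inequality over to the sample. *)
Lemma coarse_points (p q eps d : R) (m : nat) : 1 < p -> 1 < q -> 0 < eps < 1 ->
  nikolskii E L p A -> nikolskii E L q A ->
  0 < d -> d <= mesh p eps -> d <= mesh q eps -> (0 < m)%N ->
  coarse_bound (eps / 16) d <= m%:R ->
  exists X : seq T, [/\ size X = m, discretizes E L p eps X & discretizes E L q eps X].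
Proof.
move=> p1 q1 eps01 nikp nikq d0 dp dq m0 mb.
have [js1 [ok1 w1 H1]] := coarse_tests p1 eps01 nikp d0 dp m0 mb.
have [js2 [ok2 w2 H2]] := coarse_tests q1 eps01 nikq d0 dq m0 mb.
have [|j|| X Xm HX] := @bernstein_points R T E _ (js1 ++ js2) (fun j => j.1)
  (fun j => j.2.1) (fun j => j.2.2) (eps / 16 / 2) m.
- by move: eps01 => /andP[]; lra.
- by rewrite mem_cat => /orP[/ok1|/ok2].
- by rewrite big_cat /=; move: w1 w2; lra.
exists X; split => //.
- by apply: H1 => // j jj; rewrite /passes Xm; apply: HX; rewrite mem_cat jj.
- by apply: H2 => // j jj; rewrite /passes Xm; apply: HX; rewrite mem_cat jj orbT.
Qed.

End Coarse.

(** * Second stage: sampling from finitely many points *)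

Definition average (R : realType) (n : nat) : expectation R 'I_n.+1.
Proof.
refine (@Expectation R 'I_n.+1 setT (fun f => n.+1%:R^-1 * \sum_i f i) _ _ _ _ _ _ _) => //.
- move=> f _; exists (\sum_i `|f i|) => x.
  by rewrite (bigD1 x)//= lerDl sumr_ge0.
- by move=> c; rewrite sumr_const card_ord -[c *+ _]mulr_natl mulKf// pnatr_eq0.
- by move=> a f g _ _; rewrite big_split -mulr_sumr /= mulrDr mulrCA.
- by move=> f g _ _ fg; rewrite ler_wpM2l ?invr_ge0// ler_sum.
Defined.

Lemma fine_points (R : realType) (n0 : nat) (L : set ('I_n0.+1 -> R)) (p eps A : R)
    (m : nat) : 1 < p -> 0 < eps < 1 -> 1 <= A -> lin_closed L ->
  nikolskii (average R n0) L (Num.max p 2) A -> (0 < m)%N ->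
  ln (2 * A / (eps / 16)) / ln 2 * (A * (ln (2 * n0.+1).+1%:R * (130 + 2 `^ p)
     * mesh p eps `^ (- p) + 4)) <= (eps / 16) ^+ 2 / 2 * m%:R ->
  exists2 X, size X = m & discretizes (average R n0) L p eps X.
Proof.
move=> p1 eps01 A1 Llin nik m0 mb; set E := average R n0 in nik *.
have Ldom f : L f -> dom E f by [].
have /andP[e0 e1] := eps01.
have A0 : 0 < A by lra.
have p0 : 0 < p by lra.
have nikp : nikolskii E L p A.
  by apply: nikolskii_le nik => //; [rewrite le_max lexx|exact: ltW].
(* The lower bound on [2^n] makes the tail below the last level negligible; the upper bound keeps
   the number of levels logarithmic in [A]. *)
have [|n /andP[n1 n2]] := @pow2_between R (A / (eps / 16)).
  by rewrite ler_pdivlMr ?mul1r; lra.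
have mesh0 := mesh_gt0 p1 e0.
have t0 l : 0 < A `^ p^-1 / 2 ^+ l by rewrite divr_gt0 ?powR_gt0 ?exprn_gt0.
have tA l : (A `^ p^-1 / 2 ^+ l) `^ p <= A.
  apply: (le_trans (level_pow l p1 A1)).
  by rewrite ler_pdivrMr ?exprn_gt0// ler_peMr ?(ltW A0)// exprn_ege1// ler1n.
pose a l := ln (2 * n0.+1).+1%:R * ((130 + 2 `^ p) *
  (A * (mesh p eps * (A `^ p^-1 / 2 ^+ l)) `^ (- p))).
have exG l : exists G : seq ('I_n0.+1 -> R), (size G)%:R <= expR (a l) /\
    covers E L p (mesh p eps * (A `^ p^-1 / 2 ^+ l)) G.
  have [||G sG cG] := finite_cover p1 A1 Ldom Llin nik
      (t := mesh p eps * (A `^ p^-1 / 2 ^+ l)).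
  - exact: mulr_gt0.
  - apply: le_trans (tA l); apply: ge0_ler_powR; rewrite ?nnegrE ?(ltW p0) ?(ltW (t0 l))//.
      by rewrite mulr_ge0 ?(ltW mesh0) ?(ltW (t0 l)).
    rewrite ger_pMl//; apply: le_trans (mesh_le p1 eps01) _; lra.
  by exists G; split => //; rewrite card_ord in sG.
have [G HG] := choice exG.
have [|j|| X Xm HX] := @bernstein_points R _ E _ (level_tests p A n G a) (fun j => j.1)
  (fun j => j.2.1) (fun j => j.2.2) (eps / 16 / 2) m.
- lra.
- by apply: level_testsP.
- have := @level_tests_weight R _ p A n G a (fun l _ => (HG l).1); lra.
have pX j : j \in level_tests p A n G a -> passes E (eps / 16 / 2) X j.
  by move=> /HX; rewrite /passes Xm.
exists X => //.
apply: (@level_tests_points _ _ E L p eps A n G a) => //; rewrite ?Xm//.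
- apply: (le_trans (level_pow n p1 A1)).
  by rewrite ler_pdivrMr ?exprn_gt0// mulrC -ler_pdivrMr//; lra.
- by move=> l _; exact: (HG l).2.
apply: le_trans mb.
set Q := ln (2 * n0.+1).+1%:R * _ * _.
have ln2 : 0 < ln 2 :> R by rewrite ln_gt0// ltr1n.
have nln : n%:R <= ln (2 * A / (eps / 16)) / ln 2.
  rewrite ler_pdivlMr// [leLHS]mulr_natl -lnXn// ler_ln ?posrE ?exprn_gt0//.
    by rewrite -mulrA.
  by rewrite divr_gt0 ?mulr_gt0//; lra.
have Q0 : 0 <= Q.
  have l0 : 0 <= ln (2 * n0.+1).+1%:R :> R by rewrite ln_ge0// ler1n.
  exact: (mulr_ge0 (mulr_ge0 l0 (addr_ge0 (ler0n _ 130) (powR_ge0 _ _))) (powR_ge0 _ _)).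
apply: (@le_trans _ _ (n%:R * (A * (Q + 4)))); last first.
  by rewrite ler_wpM2r// mulr_ge0 ?addr_ge0 ?(ltW A0).
rewrite mulr_natl -[in leRHS](card_ord n) -sumr_const; apply: ler_sum => l _.
rewrite [leLHS]mulrDr [leRHS]mulrDr; apply: lerD; last first.
  by rewrite (mulrC A); exact: level_nat_le.
(* The factor [t^p] of the test bound cancels the [t^(-p)] of the net exponent, so every level has
   the same cost [A * Q]. *)
rewrite /a; have := t0 l; set tl := _ / 2 ^+ l => tl0.
rewrite powRM ?(ltW mesh0) ?(ltW tl0)// (powRN tl) /Q le_eqVlt; apply/orP; left; apply/eqP.
by field; rewrite gt_eqF// powR_gt0.
Qed.

(** As [ln x >= ln 2], the constant [ln c] is absorbed into a multiple of [ln x]. *)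
Lemma ln_le_lnM (R : realType) (c x : R) (k : nat) : 1 <= c -> 2 <= x ->
  ln (c * x ^+ k) <= (ln c / ln 2 + k%:R) * ln x.
Proof.
move=> c1 x2; have ln2 : 0 < ln 2 :> R by rewrite ln_gt0// ltr1n.
have x0 : 0 < x by lra.
rewrite lnM ?posrE ?exprn_gt0//; last lra.
rewrite mulrDl lnXn// mulr_natl lerD2r.
rewrite mulrAC -mulrA ler_peMr ?ln_ge0// ler_pdivlMr// mul1r.
by rewrite ler_ln ?posrE.
Qed.

Lemma discretization (R : realType) (p M eps : R) : 1 < p -> 1 <= M -> 0 < eps < 1 ->
  exists2 C : R, 0 < C &
  forall (T : Type) (E : expectation R T) (L : set (T -> R)) (N : nat) (e : nat -> T -> R),
    (2 <= N)%N -> (forall f, L f -> dom E f) -> lin_closed L ->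
    (forall i, (i < N)%N -> L (e i)) -> (forall f, L f -> nat_span N e f) ->
    nikolskii E L (Num.max p 2) (M * N%:R) ->
  forall m : nat, C * N%:R * ln N%:R `^ Num.max p 2 <= m%:R ->
  exists2 X : seq T, size X = m & discretizes E L p eps X.
Proof.
move=> p1 M1 /andP[eps0 eps1]; set q := Num.max p 2.
have pq : p <= q by rewrite le_max lexx.
have q2 : 2 <= q by rewrite le_max lexx orbT.
have q1 : 1 < q by lra.
(* The two stages together err by at most [e1 + e1 * (1 + e1) <= 3 * e1]. *)
pose e1 := eps / 3; have e01 : 0 < e1 < 1 by rewrite /e1; lra.
have /andP[e10 e11] := e01.
pose kap := e1 / 16; have kap0 : 0 < kap by rewrite /kap; lra.
have kap1 : kap <= 1 by rewrite /kap; lra.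
pose d := Num.min (mesh p e1) (mesh q e1).
have d0 : 0 < d by rewrite lt_min !mesh_gt0.
have M0 : 0 < M by lra.
have ln2 : 0 < ln 2 :> R by rewrite ln_gt0// ltr1n.
pose C1 := 4 * M ^+ 2 / kap ^+ 3 * (4 * M ^+ 4 / (d * kap) + 2 * M / kap + 4).
have C10 : 0 < C1.
  rewrite mulr_gt0 ?divr_gt0 ?mulr_gt0 ?exprn_gt0//.
  have : 0 < 4 * M ^+ 4 / (d * kap) := divr_gt0 (mulr_gt0 (ltr0Sn _ 3) (exprn_gt0 4 M0)) (mulr_gt0 d0 kap0).
  have : 0 < 2 * M / kap := divr_gt0 (mulr_gt0 (ltr0Sn _ 1) M0) kap0.
  lra.
(* [c1 * ln N] will bound the logarithm in the net sizes on the first sample, [c2 * ln N] the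
   logarithm that counts levels, and [c3] collects the cost of the second stage. *)
pose c1 := ln (2 * C1 + 3) / ln 2 + 8%:R.
pose c2 := ln (4 * M / kap) / ln 2 + 1%:R.
pose mp := (130 + 2 `^ p) * mesh p e1 `^ (- p).
pose c3 := c2 / ln 2 * (2 * M * (c1 * mp + 4 / ln 2)).
have mp0 : 0 < mp.
  by rewrite mulr_gt0 ?powR_gt0 ?mesh_gt0// addr_gt0// powR_gt0.
have Mk1 : 1 <= 4 * M / kap by rewrite ler_pdivlMr// mul1r; lra.
have c10 : 0 < c1.
  have x1 : 1 <= 2 * C1 + 3 by lra.
  by apply: ltr_wpDl (divr_ge0 (ln_ge0 x1) (ltW ln2)) _; rewrite ltr0n.
have c20 : 0 < c2 by apply: ltr_wpDl (divr_ge0 (ln_ge0 Mk1) (ltW ln2)) _; rewrite ltr0n.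
have c30 : 0 < c3.
  apply: mulr_gt0 (divr_gt0 c20 ln2) (mulr_gt0 (mulr_gt0 (ltr0Sn _ 1) M0) _).
  exact: addr_gt0 (mulr_gt0 c10 mp0) (divr_gt0 (ltr0Sn _ 3) ln2).
(* The argument needs only [N * (ln N)^2] points; the factor [(ln 2)^(2-q)] converts the square into
   the power [q >= 2], as [ln N >= ln 2]. *)
have C0 : 0 < c3 * 2 / kap ^+ 2 * ln 2 `^ (2 - q).
  exact: mulr_gt0 (divr_gt0 (mulr_gt0 c30 (ltr0Sn _ 1)) (exprn_gt0 2 kap0)) (powR_gt0 _ ln2).
exists (c3 * 2 / kap ^+ 2 * ln 2 `^ (2 - q)) => //.
move=> T E L N e N2 Ldom Llin Le spanL nik m mC.
have NR : 2 <= N%:R :> R by rewrite ler_nat.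
have N0 : (0 < N)%N by apply: leq_trans N2.
have N1 : 1 <= N%:R :> R by lra.
have lnN : ln 2 <= ln N%:R :> R by rewrite ler_ln ?posrE//; lra.
have lnN0 : 0 < ln N%:R :> R by apply: lt_le_trans lnN.
pose A := M * N%:R; have A1 : 1 <= A by rewrite /A -[leLHS]mulr1 ler_pM.
have nikp : nikolskii E L p A := nikolskii_le p1 pq (le_trans ler01 A1) Ldom nik.
have nik2 : nikolskii E L 2 A := nikolskii_le (ltr1n _ 2) q2 (le_trans ler01 A1) Ldom nik.
(* The exponent 8 comes from the leading term [A^2 * A^4 * N^2] of [coarse_bound] at [A = M * N]. *)
pose n0 := Num.truncn (C1 * N%:R ^+ 8).
have NX0 : 0 < N%:R ^+ 8 :> R by rewrite exprn_gt0 ?ltr0n.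
have cb : coarse_bound A N kap d <= n0.+1%:R.
  apply: le_trans (ltW (truncnS_gt _)).
  rewrite /coarse_bound /A /C1.
  have -> : 4 * (M * N%:R) ^+ 2 / kap ^+ 3 * (4 * (M * N%:R) ^+ 4 * N%:R ^+ 2 / (d * kap)
      + 2 * (M * N%:R) / kap + 4) =
    (4 * M ^+ 2 / kap ^+ 3 * N%:R ^+ 2) * (4 * M ^+ 4 / (d * kap) * N%:R ^+ 6
      + 2 * M / kap * N%:R + 4) by field; rewrite !gt_eqF.
  have -> : 4 * M ^+ 2 / kap ^+ 3 * (4 * M ^+ 4 / (d * kap) + 2 * M / kap + 4) * N%:R ^+ 8 =
    (4 * M ^+ 2 / kap ^+ 3 * N%:R ^+ 2) * (4 * M ^+ 4 / (d * kap) * N%:R ^+ 6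
      + 2 * M / kap * N%:R ^+ 6 + 4 * N%:R ^+ 6) by field; rewrite !gt_eqF.
  have k0 : 0 <= 4 * M ^+ 2 / kap ^+ 3 * N%:R ^+ 2.
    apply: mulr_ge0; last exact: exprn_ge0.
    exact: ltW (divr_gt0 (mulr_gt0 (ltr0Sn _ 3) (exprn_gt0 2 M0)) (exprn_gt0 3 kap0)).
  apply: (ler_wpM2l k0); rewrite -!addrA lerD2l; apply: lerD.
    apply: ler_wpM2l; first exact: ltW (divr_gt0 (mulr_gt0 (ltr0Sn _ 1) M0) kap0).
    by rewrite -[leLHS]expr1; apply: ler_weXn2l.
  by rewrite ler_peMr// exprn_ege1.
have dp : d <= mesh p e1 by rewrite ge_min lexx.
have dq : d <= mesh q e1 by rewrite ge_min lexx orbT.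
have [Y [Yn Yp Yq]] := coarse_points A1 N0 Ldom Llin Le spanL nik2 p1 q1 e01 nikp nik
  d0 dp dq (ltn0Sn n0) cb.
have Yn' : size Y == n0.+1 by apply/eqP.
(* Indexing by position counts repeated points with multiplicity. *)
pose y := tnth (Tuple Yn').
pose L' := [set g | exists2 f, L f & g = f \o y].
pose E' := average R n0.
have sumY (F : T -> R) : \sum_(x <- Y) F x = n0.+1%:R * ev E' (F \o y).
  rewrite /E' /= mulrA mulfV ?mul1r; last by rewrite pnatr_eq0.
  by rewrite -(big_tuple _ _ (Tuple Yn') xpredT).
have n1R : 0 < n0.+1%:R :> R by rewrite ltr0n.
have avgE r f : discretizes E L r e1 Y -> L f ->
    `|ev E' (fun i => `|f (y i)| `^ r) - ev E (fun x => `|f x| `^ r)|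
      <= e1 * ev E (fun x => `|f x| `^ r).
  move=> /(_ f) H /H; rewrite Yn sumY -mulrBr normrM gtr0_norm//.
  by rewrite (mulrC e1 n0.+1%:R) -mulrA ler_pM2l.
have A'1 : 1 <= 2 * A by clear -A1; lra.
have L'lin : lin_closed L'.
  move=> a _ _ [f Lf ->] [g Lg ->]; exists (fun x => a * f x + g x) => //.
  exact: lin_comb.
(* As [e1 <= 1 / 2], the norm on the sample is at least half the original one, so the constant only
   doubles. *)
have nik' : nikolskii E' L' q (2 * A).
  move=> _ i [f Lf ->]; apply: (le_trans (nik f (y i) Lf)).
  have := avgE q f Yq Lf; rewrite ler_norml; set ef := ev E _; set eg := ev E' _.
  move=> /andP[H _]; rewrite -/A.
  have -> : 2 * A * eg = A * (2 * eg) by ring.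
  apply: (ler_wpM2l (le_trans ler01 A1)).
  have ef0 : 0 <= ef.
    by apply: ev_ge0 => [|x]; [apply: dom_powR => //; exact: Ldom|exact: powR_ge0].
  have e12 : e1 <= 2^-1 by rewrite /e1; clear -eps1; lra.
  by have := ler_wpM2r ef0 e12; clear -H; lra.
have lnq : ln N%:R ^+ 2 <= ln 2 `^ (2 - q) * ln N%:R `^ q :> R.
  have -> : ln N%:R `^ q = ln N%:R ^+ 2 * ln N%:R `^ (q - 2).
    rewrite -powR_mulrn ?(ltW lnN0)// -powRD; last by rewrite (gt_eqF lnN0) implybT.
    by congr (_ `^ _); ring.
  rewrite mulrCA ler_peMr ?exprn_ge0 ?(ltW lnN0)//.
  rewrite (_ : 2 - q = - (q - 2)); last by ring.
  rewrite powRN mulrC ler_pdivlMr ?powR_gt0// mul1r.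
  by apply: ge0_ler_powR; rewrite ?nnegrE ?(ltW ln2) ?(ltW lnN0)//; lra.
have c3m : c3 * N%:R * ln N%:R ^+ 2 <= kap ^+ 2 / 2 * m%:R.
  have k2 : 0 <= kap ^+ 2 / 2 by rewrite divr_ge0// exprn_ge0// ltW.
  apply: le_trans (ler_wpM2l k2 mC).
  have -> : kap ^+ 2 / 2 * (c3 * 2 / kap ^+ 2 * ln 2 `^ (2 - q) * N%:R * ln N%:R `^ q) =
    c3 * N%:R * (ln 2 `^ (2 - q) * ln N%:R `^ q) by field; rewrite gt_eqF.
  by rewrite ler_wpM2l// mulr_ge0 ?(ltW c30).
have m0 : (0 < m)%N.
  rewrite -(ltr0n R); apply: lt_le_trans mC.
  by apply: mulr_gt0 (mulr_gt0 C0 _) (powR_gt0 _ lnN0); rewrite ltr0n.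
have [|X Xm HX] := fine_points p1 e01 A'1 L'lin nik' m0.
  apply: le_trans c3m; rewrite -/kap.
  have l1 : ln (2 * n0.+1).+1%:R <= c1 * ln N%:R :> R.
    have x1 : 1 <= 2 * C1 + 3 by clear -C10; lra.
    apply: le_trans (ln_le_lnM 8 x1 NR).
    have x0 : 0 < (2 * C1 + 3) * N%:R ^+ 8 by apply: mulr_gt0 NX0; clear -C10; lra.
    rewrite ler_ln ?posrE ?ltr0n//.
    have NX1 : 1 <= N%:R ^+ 8 :> R by rewrite exprn_ege1.
    have n0C : n0%:R <= C1 * N%:R ^+ 8 by rewrite truncn_le; exact: ltW (mulr_gt0 C10 NX0).
    have -> : (2 * n0.+1).+1%:R = 2 * n0%:R + 3 :> R.
      by rewrite -[(2 * n0.+1).+1]addn1 natrD natrM -[n0.+1]addn1 natrD; ring.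
    by clear -n0C NX1; lra.
  have l2 : ln (2 * (2 * A) / kap) <= c2 * ln N%:R.
    apply: le_trans (ln_le_lnM 1 Mk1 NR); rewrite expr1 /A le_eqVlt; apply/orP; left.
    by apply/eqP; congr ln; field; rewrite gt_eqF.
  have h4 : 4 <= 4 / ln 2 * ln N%:R :> R by rewrite mulrAC ler_pdivlMr// ler_wpM2l.
  have l1' : ln (2 * n0.+1).+1%:R * (130 + 2 `^ p) * mesh p e1 `^ (- p) <=
      c1 * ln N%:R * mp.
    by rewrite -[leLHS]mulrA; apply: (ler_wpM2r (ltW mp0) l1).
  have -> : c3 * N%:R * ln N%:R ^+ 2 =
    (c2 * ln N%:R) / ln 2 * (2 * A * (c1 * ln N%:R * mp + 4 / ln 2 * ln N%:R)).
    by rewrite /c3 /A; field; rewrite gt_eqF.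
  have mpos : 0 <= ln (2 * n0.+1).+1%:R * (130 + 2 `^ p) * mesh p e1 `^ (- p).
    have l0 : 0 <= ln (2 * n0.+1).+1%:R :> R by rewrite ln_ge0// ler1n.
    exact: (mulr_ge0 (mulr_ge0 l0 (addr_ge0 (ler0n _ 130) (powR_ge0 _ _))) (powR_ge0 _ _)).
  apply: ler_pM.
  - apply: divr_ge0 (ltW ln2); rewrite ln_ge0// ler_pdivlMr// mul1r.
    by clear -A'1 kap1; lra.
  - apply: mulr_ge0; first by clear -A'1; lra.
    by clear -mpos; lra.
  - by rewrite ler_wpM2r// invr_ge0 ltW.
  apply: ler_wpM2l; first by clear -A'1; lra.
  by clear -l1' h4; lra.
exists [seq y i | i <- X]; first by rewrite size_map.
move=> f Lf; rewrite size_map big_map.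
have := HX (f \o y) (ex_intro2 _ _ f Lf erefl); rewrite /= -/E'.
have := avgE p f Yp Lf; rewrite Xm.
set ef := ev E _; set eg := ev E' _; set S := \sum_(_ <- _) _.
have -> : n0.+1%:R^-1 * (\sum_(i < n0.+1) `|f (y i)| `^ p) = eg by [].
have ef0 : 0 <= ef.
  by apply: ev_ge0 => [|x]; [apply: dom_powR => //; exact: Ldom|exact: powR_ge0].
rewrite !ler_norml => /andP[a1 a2] /andP[b1 b2].
have mR : 0 <= m%:R :> R by [].
have e1m : 0 <= e1 * m%:R by rewrite mulr_ge0// ltW.
have a1' := ler_wpM2l mR a1; have a2' := ler_wpM2l mR a2.
have a2'' := ler_wpM2l e1m a2.
have epsE : eps = 3 * e1 by rewrite /e1; field.
have eem : e1 * m%:R * (e1 * ef) <= e1 * m%:R * ef.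
  by rewrite ler_wpM2l// ler_piMl// ltW.
by rewrite epsE; clear -b1 b2 a1' a2' a2'' eem; lra.
Qed.

(** * Integration of continuous functions on a compact space *)

Lemma continuous_borel_measurable (R : realType) (Omega : ptopologicalType) (f : Omega -> R) :
  continuous f -> measurable_fun [set: borelType Omega] (f : borelType Omega -> R).
Proof.
move=> /continuousP cf; apply: (measurability _ (measurable_realfun.RGenOpens.measurableE R)).
move=> _ [_ [a [b ->] <-]]; rewrite setTI; apply: sub_sigma_algebra.
exact/cf/interval_open.
Qed.

Section BorelExpectation.
Context (R : realType) (Omega : ptopologicalType) (mu : probability (borelType Omega) R).
Hypothesis cpt : compact [set: Omega].

Let muT : mu [set: borelType Omega] = 1%E.
Proof. exact: probability_setT. Qed.

Lemma continuous_compact_bound (f : Omega -> R) :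
  continuous f -> exists b, forall x, `|f x| <= b.
Proof.
move=> cf.
have cfT : {within [set: Omega], continuous f} by exact: continuous_subspaceT.
have [M [_ HM]] := @compact_bounded R R^o _ (continuous_compact cfT cpt).
by exists (`|M| + 1) => x; apply: HM; [rewrite ltr_pwDr// ler_norm|exists x].
Qed.

Lemma continuous_integrable (f : Omega -> R) :
  continuous f -> mu.-integrable [set: borelType Omega] (EFin \o f).
Proof.
move=> cf; apply: measurable_bounded_integrable => //.
- by have H : (mu [set: borelType Omega] < +oo)%E; [rewrite muT ltry|exact: H].
- exact: continuous_borel_measurable.
have [b fb] := continuous_compact_bound cf.
by exists b; split; [exact: num_real|move=> M bM x _; apply: le_trans (fb x) (ltW bM)].
Qed.

Definition borel_expectation : expectation R Omega.
Proof.
refine (@Expectation R Omega [set f | continuous f]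
  (fun f => \int[mu]_x (f : borelType Omega -> R) x) _ _ _ _ _ _ _).
- by move=> c; exact: cst_continuous.
- move=> a f g cf cg x; apply: cvgD; [apply: cvgM; [exact: cvg_cst|exact: cf]|exact: cg].
- by move=> phi f cphi cf x; apply: (@continuous_comp _ _ _ f phi); [exact: cf|exact: cphi].
- exact: continuous_compact_bound.
- move=> c; rewrite Rintegral_cst// -[RHS]mulr1; congr (_ * _).
  by rewrite -[RHS]/(fine 1%E); congr fine; exact: muT.
- move=> a f g cf cg; have If := continuous_integrable cf; have Ig := continuous_integrable cg.
  rewrite RintegralD ?RintegralZl//.
  have := integrableZl measurableT a If.
  by congr (integrable _ _ _); apply/funext => x /=; rewrite EFinM.
- move=> f g cf cg fg; apply: le_Rintegral => //; exact: continuous_integrable.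
Defined.

Lemma poweR_Lnorm_continuous (r : R) (f : Omega -> R) : 1 < r -> continuous f ->
  ('N[mu]_r%:E[EFin \o f] `^ r)%E = (ev borel_expectation (fun x => `|f x| `^ r))%:E.
Proof.
move=> r1 cf; rewrite poweR_Lnorm; last by rewrite gt_eqF; lra.
have cr : continuous (fun x => `|f x| `^ r).
  by have := dom_powR r1 (cf : dom borel_expectation f).
rewrite /= /Rintegral fineK; last exact: integrable_fin_num (continuous_integrable cr).
by apply: eq_integral => x _; rewrite -poweR_EFin.
Qed.

Lemma sup_norm_nikolskii (r B : R) (f : Omega -> R) (x : Omega) : 1 < r -> 0 <= B ->
  continuous f -> (sup_norm f <= B%:E * 'N[mu]_r%:E[EFin \o f])%E ->
  `|f x| `^ r <= B `^ r * ev borel_expectation (fun y => `|f y| `^ r).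
Proof.
move=> r1 B0 cf fB; have r0 : 0 < r by lra.
have fx : (`|f x|%:E <= B%:E * 'N[mu]_r%:E[EFin \o f])%E.
  by apply: le_trans fB; apply: ereal_sup_ubound; exists x.
have := gt0_ler_poweR (ltW r0) _ _ fx.
rewrite poweR_EFin poweRM ?lee_fin ?Lnorm_ge0// poweR_Lnorm_continuous//.
rewrite poweR_EFin -EFinM lee_fin; apply.
  by rewrite in_itv /= lee_fin normr_ge0 leey.
by rewrite in_itv /= mule_ge0 ?lee_fin ?Lnorm_ge0//= leey.
Qed.

End BorelExpectation.

(** * Discretization for subspaces of continuous functions *)

Theorem theoremA :
  forall (R : realType) (p M eps : R), 1 < p -> 1 <= M -> 0 < eps < 1 ->
  exists2 C : R, 0 < C &
  forall (Omega : ptopologicalType) (mu : probability (borelType Omega) R),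
    compact [set: Omega] ->
  forall (N : nat) (L : set (Omega -> R)), (2 <= N)%N ->
    subspace_of_dim N L ->
    (forall f : Omega -> R, L f ->
       f \in Lfun mu p%:E /\ continuous f) ->
    (forall f : Omega -> R, L f ->
       (sup_norm f <= (M * N%:R `^ (Num.max p 2)^-1)%:E
                      * 'N[mu]_(Num.max p 2)%:E[EFin \o f])%E) ->
  forall m : nat, C * N%:R * ln N%:R `^ Num.max p 2 <= m%:R ->
  exists X : 'I_m -> Omega,
    forall f : Omega -> R, L f ->
      ((1 - eps)%:E * 'N[mu]_(p%:E)[EFin \o f] `^ p
         <= (m%:R^-1 * \sum_(j < m) `|f (X j)| `^ p)%:E)%E
      /\ ((m%:R^-1 * \sum_(j < m) `|f (X j)| `^ p)%:E
         <= (1 + eps)%:E * 'N[mu]_(p%:E)[EFin \o f] `^ p)%E.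
Proof.
move=> R p M eps p1 M1 eps01; set q := Num.max p 2.
have q1 : 1 < q by rewrite lt_max p1.
have q0 : 0 < q by lra.
have Mq1 : 1 <= M `^ q by apply: le_trans M1 (le1r_powR M1 (ltW q1)).
(* Raised to the power [q], the sup-norm hypothesis has constant [M^q * N], so [M^q] takes the place
   of [M]. *)
have [C C0 HC] := discretization p1 Mq1 eps01.
exists C => // Omega mu cpt [//|N] L N2 [Lsub [e [_ LE]]] Lcont Lsup m Cm.
pose E := borel_expectation mu cpt.
have Ldom f : L f -> dom E f by move=> /Lcont[].
have Llin : lin_closed L.
  move=> a f g Lf Lg; have [_ H] := Lsub.
  by have := H a f g (mem_set Lf) (mem_set Lg); rewrite inE.
(* The dimension is now a successor, so [inord] extends the basis to all natural indices. *)
pose e' (i : nat) := e (inord i).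
have Le i : (i < N.+1)%N -> L (e' i).
  move=> _; rewrite LE; exists (fun j => (j == inord i)%:R) => //.
  rewrite (bigD1 (inord i))//= eqxx scale1r big1 ?addr0// => j /negbTE ->.
  by rewrite scale0r.
have spanL f : L f -> nat_span N.+1 e' f.
  rewrite LE => -[c _ <-]; exists (fun i => c (inord i)) => x.
  rewrite fct_sumE; apply: eq_bigr => i _; rewrite /e' inord_val //.
have nik : nikolskii E L q (M `^ q * N.+1%:R).
  move=> f x Lf; have [_ cf] := Lcont f Lf.
  have B0 : 0 <= M * N.+1%:R `^ q^-1 by rewrite mulr_ge0 ?powR_ge0//; lra.
  have := sup_norm_nikolskii cpt x q1 B0 cf (Lsup f Lf).
  rewrite powRM ?powR_ge0//; last lra.
  by rewrite -powRrM mulVf ?gt_eqF// powRr1.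
have [X Xm HX] := HC Omega E L N.+1 e' N2 Ldom Llin Le spanL nik m Cm.
have m0 : 0 < m%:R :> R.
  apply: lt_le_trans Cm; rewrite !mulr_gt0 ?powR_gt0 ?ltr0n//.
  by rewrite ln_gt0// ltr1n.
have Xm' : size X == m by apply/eqP.
exists (tnth (Tuple Xm')) => f Lf; have [_ cf] := Lcont f Lf.
rewrite (poweR_Lnorm_continuous mu cpt p1 cf) -!EFinM !lee_fin.
have := HX f Lf; rewrite Xm -/E.
have -> : \sum_(x <- X) `|f x| `^ p = \sum_(j < m) `|f (tnth (Tuple Xm') j)| `^ p.
  by rewrite -(big_tuple _ _ (Tuple Xm') xpredT (fun x => `|f x| `^ p)).
rewrite ler_norml => /andP[H1 H2]; rewrite (mulrC m%:R^-1).
rewrite ler_pdivlMr// ler_pdivrMr//; lra.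
Qed.
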